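(* Let $E$ be a Banach lattice, $X$ a complete metric space and $1 \le q \le \infty$. A Lipschitz map $T : E \to X$ is Lipschitz $q$-concave if and only if there exist a $q$-concave Banach lattice $V$, a positive operator $\phi : E \to V$ (which may in fact be taken to be a lattice homomorphism with dense image), and a Lipschitz map $S : V \to X$ such that $T = S \circ \phi$. Moreover, in this case $$M_{(q)}^{\mathrm{Lip}}(T) = \inf \ \|\phi\| \cdot M_{(q)}(I_V) \cdot \mathrm{Lip}(S),$$ where the infimum is taken over all such factorizations.
   Context: $\mathrm{Lip}(\cdot)$ denotes the Lipschitz constant and $I_V$ the identity map of $V$. Banach lattices are real; expressions $(\sum_j |v_j|^q)^{1/q}$ in a Banach lattice are defined by the Krivine functional calculus. A linear map $S : E \to Z$ from a Banach lattice $E$ to a Banach space $Z$ is $q$-concave if there is $M<\infty$ such that for all $n$ and $v_1,\dots,v_n\in E$, $(\sum_{j=1}^n \|Sv_j\|^q)^{1/q} \le M \big\|(\sum_{j=1}^n |v_j|^q)^{1/q}\big\|_E$ if $q<\infty$, or $\max_{j}\|Sv_j\|\le M\big\|\bigvee_{j=1}^n |v_j|\big\|_E$ if $q=\infty$. The smallest such $M$ is $M_{(q)}(S)$. A Banach lattice $V$ is $q$-concave if $I_V:V\to V$ is $q$-concave. A map $T : E\to X$ from a Banach lattice $E$ to a metric space $(X,d)$ is Lipschitz $q$-concave if there is $C\ge 0$ such that for all $n$, all $v_j,v_j'\in E$ and $\lambda_j\ge 0$ ($1\le j\le n$), $(\sum_{j=1}^n \lambda_j d(Tv_j,Tv_j')^q)^{1/q}\le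 C\big\|(\sum_{j=1}^n \lambda_j|v_j-v_j'|^q)^{1/q}\big\|_E$ if $q<\infty$, or $\max_j \lambda_j d(Tv_j,Tv_j')\le C\big\|\bigvee_{j=1}^n \lambda_j|v_j-v_j'|\big\|_E$ if $q=\infty$. The smallest such $C$ is $M_{(q)}^{\mathrm{Lip}}(T)$. *)

(* Defs.v *)
From HB Require Import structures.
From mathcomp Require Import all_boot all_order all_algebra.
From mathcomp Require Import all_classical all_reals all_analysis.

Set Implicit Arguments.
Unset Strict Implicit.
Unset Printing Implicit Defensive.

Import Order.TTheory GRing.Theory Num.Theory.
Import numFieldNormedType.Exports.

Local Open Scope classical_set_scope.
Local Open Scope ring_scope.

(* Real Banach lattices. The order is a field of its own because
   Hierarchy-Builder rejects a join of Order.Lattice with GRing.Zmodule that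
   realDomainType does not inherit from. Only binary suprema are required:
   infima then exist, see [vmeet] and [vmeetP]. *)
HB.mixin Record isBanachLattice (R : realType) E
    & CompleteNormedModule R E := {
  vle : E -> E -> Prop ;
  vjoin : E -> E -> E ;
  vle_refl : forall x, vle x x ;
  vle_anti : forall x y, vle x y -> vle y x -> x = y ;
  vle_trans : forall y x z, vle x y -> vle y z -> vle x z ;
  vjoinP : forall x y z, vle (vjoin x y) z <-> vle x z /\ vle y z ;
  vle_add : forall x y z, vle x y -> vle (x + z) (y + z) ;
  vle_scale : forall (a : R) x y, 0 <= a -> vle x y -> vle (a *: x) (a *: y) ;
  vle_norm : forall x y, vle (vjoin x (- x)) (vjoin y (- y)) -> `|x| <= `|y|
}.

#[short(type="banachLatticeType")]
HB.structure Definition BanachLattice (R : realType) :=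
  { E of CompleteNormedModule R E & isBanachLattice R E }.

#[short(type="completeMetricType")]
HB.structure Definition CompleteMetric (K : numDomainType) :=
  { M of Metric K M & Complete M }.

Section banach_lattice.
Context {R : realType} {E : banachLatticeType R}.

Definition vabs (x : E) : E := vjoin x (- x).

Definition vmeet (x y : E) : E := - vjoin (- x) (- y).

Lemma vmeetP (x y z : E) : vle z (vmeet x y) <-> vle z x /\ vle z y.
Proof.
have opp (a b : E) : vle a b -> vle (- b) (- a).
  move=> ab; have := vle_add _ _ (- a - b) ab.
  by rewrite addrA subrr add0r addrCA subrr addr0.
have opp2 (a b : E) : vle (- b) (- a) <-> vle a b.
  by split=> /opp //; rewrite !opprK.
rewrite /vmeet -opp2 opprK vjoinP.
by split=> -[] /opp2 ? /opp2 ?.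
Qed.

End banach_lattice.

Section krivine.
Context {R : realType} {n : nat}.

Definition krivine_fun (f : 'rV[R]_n -> R) : Prop :=
  continuous f /\
  forall (t : R) (x : 'rV[R]_n), 0 <= t -> f (t *: x) = t * f x.

Context {E : banachLatticeType R}.

(* [tau] restricts to a vector lattice homomorphism on the space of continuous
   positively homogeneous functions and maps the coordinate functions to [v];
   Krivine's theorem says that there is exactly one such homomorphism. *)
Definition krivine_hom (v : 'I_n -> E) (tau : ('rV[R]_n -> R) -> E) : Prop :=
  [/\ forall j, tau (fun x => x ord0 j) = v j,
      forall (a : R) f g, krivine_fun f -> krivine_fun g ->
        tau (fun x => a * f x + g x) = a *: tau f + tau g,
      forall f g, krivine_fun f -> krivine_fun g ->
        tau (fun x => Num.max (f x) (g x)) = vjoin (tau f) (tau g) &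
      forall f g, krivine_fun f -> krivine_fun g ->
        tau (fun x => Num.min (f x) (g x)) = vmeet (tau f) (tau g)].

Definition krivine (f : 'rV[R]_n -> R) (v : 'I_n -> E) : E :=
  xget 0 [set w | exists2 tau, krivine_hom v tau & tau f = w].

End krivine.

Section concavity.
Context {R : realType}.

(* The exponent q lies in [1, +oo]; the value -oo is junk. The neutral element
   0 of the big maximum and supremum is harmless: all terms are nonnegative. *)
Definition wlq (q : \bar R) n (lam a : 'I_n -> R) : R :=
  if q is r%:E then (\sum_(j < n) lam j * a j `^ r) `^ r^-1
  else \big[Num.max/0]_(j < n) (lam j * a j).

Definition vwlq (E : banachLatticeType R) (q : \bar R) n
    (lam : 'I_n -> R) (v : 'I_n -> E) : E :=
  if q is r%:E then
    krivine (fun x : 'rV[R]_n =>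
      (\sum_(j < n) lam j * `|x ord0 j| `^ r) `^ r^-1) v
  else \big[vjoin/0]_(j < n) (lam j *: vabs (v j)).

Definition concave_bound (E : banachLatticeType R) (Z : completeNormedModType R)
    (q : \bar R) (S : {linear E -> Z}) (M : R) : Prop :=
  0 <= M /\
  forall n (v : 'I_n -> E),
    wlq q (fun=> 1) (fun j => `|S (v j)|) <= M * `|vwlq q (fun=> 1) v|.

Definition concave (E : banachLatticeType R) (Z : completeNormedModType R)
    (q : \bar R) (S : {linear E -> Z}) : Prop :=
  exists M, concave_bound q S M.

Definition concave_const (E : banachLatticeType R)
    (Z : completeNormedModType R) (q : \bar R) (S : {linear E -> Z}) : R :=
  inf [set M | concave_bound q S M].

Definition vid (V : banachLatticeType R) : {linear V -> V} := idfun.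

Definition concave_lattice (q : \bar R) (V : banachLatticeType R) : Prop :=
  concave q (vid V).

Definition lip_concave_bound (E : banachLatticeType R) (X : metricType R)
    (q : \bar R) (T : E -> X) (C : R) : Prop :=
  0 <= C /\
  forall n (v v' : 'I_n -> E) (lam : 'I_n -> R), (forall j, 0 <= lam j) ->
    wlq q lam (fun j => mdist (T (v j)) (T (v' j))) <=
    C * `|vwlq q lam (fun j => v j - v' j)|.

Definition lip_concave (E : banachLatticeType R) (X : metricType R)
    (q : \bar R) (T : E -> X) : Prop :=
  exists C, lip_concave_bound q T C.

Definition lip_concave_const (E : banachLatticeType R) (X : metricType R)
    (q : \bar R) (T : E -> X) : R :=
  inf [set C | lip_concave_bound q T C].

End concavity.

Section maps.
Context {R : realType}.

Definition lip_bound (E : normedModType R) (X : metricType R)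
    (f : E -> X) (k : R) : Prop :=
  0 <= k /\ forall x y, mdist (f x) (f y) <= k * `|x - y|.

Definition lipschitz_map (E : normedModType R) (X : metricType R)
    (f : E -> X) : Prop :=
  exists k, lip_bound f k.

Definition Lip (E : normedModType R) (X : metricType R) (f : E -> X) : R :=
  inf [set k | lip_bound f k].

Definition opnorm (E F : normedModType R) (phi : {linear E -> F}) : R :=
  inf [set k | 0 <= k /\ forall x, `|phi x| <= k * `|x|].

Definition positive_op (E V : banachLatticeType R) (phi : {linear E -> V}) :=
  forall x, vle 0 x -> vle 0 (phi x).

Definition lattice_hom (E V : banachLatticeType R) (phi : {linear E -> V}) :=
  {morph phi : x y / vjoin x y} /\ {morph phi : x y / vmeet x y}.

Definition concave_factorization (E : banachLatticeType R) (X : metricType R)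
    (q : \bar R) (T : E -> X) (V : banachLatticeType R)
    (phi : {linear E -> V}) (S : V -> X) : Prop :=
  [/\ concave_lattice q V, positive_op phi, lipschitz_map S & T = S \o phi].

End maps.

(* Main.v *)
Require Import Defs.
From HB Require Import structures.
From mathcomp Require Import all_boot all_order all_algebra.
From mathcomp Require Import all_classical all_reals all_analysis.
From mathcomp Require Import ring lra.

Set Implicit Arguments.
Unset Strict Implicit.
Unset Printing Implicit Defensive.

Import Order.TTheory GRing.Theory Num.Theory.
Import numFieldNormedType.Exports.

Local Open Scope classical_set_scope.
Local Open Scope ring_scope.

(* Call rho x the supremum of (sum lam_j d(T v_j, T v'_j)^q)^(1/q) over all
   families with (sum lam_j |v_j - v'_j|^q)^(1/q) <= |x|. This is a lattice
   seminorm on E, bounded by C |x| when T is Lipschitz q-concave with constant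
   C, and the distance from T x to T y is at most rho (x - y). Concatenating
   families shows that rho is q-concave with constant 1. So V is the completion
   of E for rho, phi the canonical map, and S the extension of T by density.
   Conversely a positive phi satisfies
   (sum |phi v_j|^q)^(1/q) <= phi ((sum |v_j|^q)^(1/q)), because the l^q norm is
   a supremum of linear functionals, and the bound for T follows.

   Inequalities between Krivine expressions are checked pointwise on R^n. This
   rests on the existence and uniqueness of the calculus: piecewise-linear
   functions are differences of finite suprema of linear forms, whose order
   relations are consequences of Gordan's theorem and hence hold in every
   vector lattice; a continuous positively homogeneous function is a uniform
   limit of those on the l^1 sphere. *)

(** Three points shape the argument. Since [T] is not linear, scaling its arguments says nothing
    about its increments; it is the weights [lam] in the definition of Lipschitz q-concavity that
    make rho homogeneous. The triangle inequality for rho is the hard property: a family dominated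
    by |x| + |y| has to be split exactly into one dominated by |x| and one dominated by |y|, so that
    [T] can be evaluated at intermediate points. This is a Riesz decomposition for l^q expressions,
    and its pieces are quotients formed inside the functional calculus. Lastly, a factorization
    assumes of [phi] only that it is positive; its boundedness comes from the completeness of [E],
    and without it [opnorm] would be the infimum of an empty set. For every admissible C the
    construction gives a product of constants at most C * 1 * 1, while every product is itself an
    admissible C; the two infima are therefore equal. *)

Section riesz.
Context {R : realType} {E : banachLatticeType R}.
Implicit Types (x y z w : E) (a b : R).

Lemma vjoin_ubl x y : vle x (vjoin x y).
Proof. by have /vjoinP[] := vle_refl (vjoin x y). Qed.

Lemma vjoin_ubr x y : vle y (vjoin x y).
Proof. by have /vjoinP[] := vle_refl (vjoin x y). Qed.

Lemma vjoin_lub x y z : vle x z -> vle y z -> vle (vjoin x y) z.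
Proof. by move=> xz yz; apply/vjoinP. Qed.

Lemma vjoinC x y : vjoin x y = vjoin y x.
Proof.
by apply: vle_anti; apply: vjoin_lub;
  (exact: vjoin_ubl || exact: vjoin_ubr).
Qed.

Lemma vle_joinE x y : vle x y <-> vjoin x y = y.
Proof.
split=> [xy|<-]; last exact: vjoin_ubl.
by apply: vle_anti; [apply: vjoin_lub => //; exact: vle_refl|exact: vjoin_ubr].
Qed.

Lemma vjoinA x y z : vjoin x (vjoin y z) = vjoin (vjoin x y) z.
Proof.
apply: vle_anti.
  apply: vjoin_lub; first exact: vle_trans (vjoin_ubl _ _) (vjoin_ubl _ _).
  apply: vjoin_lub; last exact: vjoin_ubr.
  exact: vle_trans (vjoin_ubr _ _) (vjoin_ubl _ _).
apply: vjoin_lub; last exact: vle_trans (vjoin_ubr _ _) (vjoin_ubr _ _).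
apply: vjoin_lub; first exact: vjoin_ubl.
exact: vle_trans (vjoin_ubl _ _) (vjoin_ubr _ _).
Qed.

Lemma vjoinxx x : vjoin x x = x.
Proof. by apply/vle_joinE; exact: vle_refl. Qed.

Lemma vle_add2r z x y : vle (x + z) (y + z) <-> vle x y.
Proof.
split=> [/(vle_add _ _ (- z))|]; last exact: vle_add.
by rewrite !addrK.
Qed.

Lemma vleD x y z w : vle x y -> vle z w -> vle (x + z) (y + w).
Proof.
move=> xy zw; apply: (vle_trans (y + z)); first exact: vle_add.
by rewrite ![y + _]addrC; exact: vle_add.
Qed.

Lemma vsubr_ge0 x y : vle 0 (y - x) <-> vle x y.
Proof. by rewrite -(vle_add2r x) add0r subrK. Qed.

Lemma vleN x y : vle (- x) (- y) <-> vle y x.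
Proof. by rewrite -vsubr_ge0 opprK addrC vsubr_ge0. Qed.

Lemma vle_subl x y z : vle (x - y) z <-> vle x (z + y).
Proof. by rewrite -(vle_add2r y) subrK. Qed.

Lemma vscale_ge0 a x : 0 <= a -> vle 0 x -> vle 0 (a *: x).
Proof. by move=> a0 x0; rewrite -(scaler0 _ a); exact: vle_scale. Qed.

Lemma vjoinDr x y z : vjoin x y + z = vjoin (x + z) (y + z).
Proof.
apply: vle_anti; last first.
  by apply: vjoin_lub; apply: vle_add; [exact: vjoin_ubl|exact: vjoin_ubr].
rewrite -[X in vle _ X](subrK z); apply: vle_add.
by apply: vjoin_lub; rewrite -(vle_add2r z) subrK;
  [exact: vjoin_ubl|exact: vjoin_ubr].
Qed.

Lemma vjoinZ a x y : 0 <= a -> a *: vjoin x y = vjoin (a *: x) (a *: y).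
Proof.
rewrite le_eqVlt => /predU1P[<-|a0]; first by rewrite !scale0r vjoinxx.
apply: vle_anti; last first.
  by apply: vjoin_lub; apply: vle_scale; rewrite ?ltW //;
    [exact: vjoin_ubl|exact: vjoin_ubr].
rewrite -[X in vle _ X](scalerKV (lt0r_neq0 a0)); apply: vle_scale; first exact: ltW.
apply: vjoin_lub; rewrite -[X in vle X _](scalerK (lt0r_neq0 a0));
  (apply: vle_scale; first by rewrite invr_ge0 ltW);
  [exact: vjoin_ubl|exact: vjoin_ubr].
Qed.

Lemma vmeetE x y : vmeet x y = x + y - vjoin x y.
Proof.
rewrite /vmeet -[x + y - _]opprK; congr (- _).
by rewrite opprB vjoinDr vjoinC opprD; congr vjoin;
  [rewrite addrA subrr add0r|rewrite addrCA subrr addr0].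
Qed.

Lemma vabs_ub x : vle x (vabs x).
Proof. exact: vjoin_ubl. Qed.

Lemma vabs_ubN x : vle (- x) (vabs x).
Proof. exact: vjoin_ubr. Qed.

Lemma vabs_lub x y : vle x y -> vle (- x) y -> vle (vabs x) y.
Proof. exact: vjoin_lub. Qed.

Lemma vabsN x : vabs (- x) = vabs x.
Proof. by rewrite /vabs opprK vjoinC. Qed.

Lemma vabsBC x y : vabs (x - y) = vabs (y - x).
Proof. by rewrite -vabsN opprB. Qed.

(** Adding [x] and [- x], both below [vabs x], shows that twice the modulus is nonnegative; it
    remains to halve. *)
Lemma vabs_ge0 x : vle 0 (vabs x).
Proof.
have := vleD (vabs_ub x) (vabs_ubN x); rewrite subrr => h.
have := @vscale_ge0 2^-1 _ _ h; rewrite invr_ge0 ler0n => /(_ isT).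
by rewrite scalerDr -scalerDl (_ : 2^-1 + 2^-1 = 1 :> R) ?scale1r //; field.
Qed.

Lemma vabs_id x : vle 0 x -> vabs x = x.
Proof.
move=> x0; rewrite /vabs vjoinC; apply/vle_joinE.
by apply: (vle_trans 0) => //; rewrite -vleN opprK oppr0.
Qed.

Lemma vabs_abs x : vabs (vabs x) = vabs x.
Proof. exact/vabs_id/vabs_ge0. Qed.

Lemma vabs0 : vabs (0 : E) = 0.
Proof. by rewrite vabs_id //; exact: vle_refl. Qed.

Lemma vabsD x y : vle (vabs (x + y)) (vabs x + vabs y).
Proof.
apply: vabs_lub; first by apply: vleD; exact: vabs_ub.
by rewrite opprD; apply: vleD; exact: vabs_ubN.
Qed.

Lemma vabsZ a x : vabs (a *: x) = `|a| *: vabs x.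
Proof.
have pos b : 0 <= b -> vabs (b *: x) = b *: vabs x.
  by move=> b0; rewrite /vabs vjoinZ // scalerN.
have [a0|a0] := leP 0 a; first by rewrite pos // ger0_norm.
by rewrite -vabsN -scaleNr pos ?ltr0_norm // oppr_ge0 ltW.
Qed.

(** Adding both moduli to the join of [z] and [w] gives an upper bound of [x] and of [y]. This makes
    joins continuous for the norm, and later for any lattice seminorm. *)
Lemma vjoin_lipschitz x y z w :
  vle (vabs (vjoin x y - vjoin z w)) (vabs (x - z) + vabs (y - w)).
Proof.
have bound (t s c j : E) : vle 0 c -> vle s j -> vle t (vabs (t - s) + c + j).
  move=> c0 sj; have := vleD (vleD (vabs_ub (t - s)) c0) sj.
  by rewrite addr0 subrK.
have half (x1 y1 z1 w1 : E) :
    vle (vjoin x1 y1 - vjoin z1 w1) (vabs (x1 - z1) + vabs (y1 - w1)).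
  apply/vle_subl; apply: vjoin_lub.
    by apply: bound; [exact: vabs_ge0|exact: vjoin_ubl].
  rewrite [vabs _ + vabs _]addrC.
  by apply: bound; [exact: vabs_ge0|exact: vjoin_ubr].
apply: vabs_lub; first exact: half.
by rewrite opprB vabsBC (vabsBC y); exact: half.
Qed.

Lemma norm_vabs x : `|vabs x| = `|x|.
Proof.
by apply/eqP; rewrite eq_le; apply/andP; split; apply: vle_norm;
  rewrite -/(vabs (vabs x)) vabs_abs; exact: vle_refl.
Qed.

Lemma le_vabs_norm x y : vle (vabs x) y -> `|x| <= `|y|.
Proof.
by move=> xy; apply: vle_norm; apply: vle_trans xy _; exact: vabs_ub.
Qed.

Lemma norm_vjoin_lipschitz x y z w :
  `|vjoin x y - vjoin z w| <= `|x - z| + `|y - w|.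
Proof.
rewrite -[`|x - z|]norm_vabs -[`|y - w|]norm_vabs.
apply: le_trans (ler_normD _ _); apply: le_vabs_norm; exact: vjoin_lipschitz.
Qed.

Lemma vsum_ge0 (I : Type) (r : seq I) (P : pred I) (F : I -> E) :
  (forall i, P i -> vle 0 (F i)) -> vle 0 (\sum_(i <- r | P i) F i).
Proof.
move=> F0; elim/big_rec : _ => [|i x Pi x0]; first exact: vle_refl.
by rewrite -[0]addr0; apply: vleD => //; exact: F0.
Qed.

Lemma vle_sum (I : Type) (r : seq I) (P : pred I) (F G : I -> E) :
  (forall i, P i -> vle (F i) (G i)) ->
  vle (\sum_(i <- r | P i) F i) (\sum_(i <- r | P i) G i).
Proof.
move=> FG; rewrite -vsubr_ge0 -sumrB; apply: vsum_ge0 => i Pi.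
by rewrite vsubr_ge0; exact: FG.
Qed.

End riesz.

(** * Krivine functional calculus *)

Section gordan.
Context {R : realType}.

Lemma continuous_sum_fun (T : topologicalType) (I : Type) (r : seq I)
    (P : pred I) (F : I -> T -> R) :
  (forall i, P i -> continuous (F i)) ->
  continuous (fun x => \sum_(i <- r | P i) F i x).
Proof.
move=> cF; elim: r => [|i r IH].
  rewrite (_ : (fun _ => _) = cst 0); first exact: cst_continuous.
  by apply/funext => x; rewrite big_nil.
under eq_fun do rewrite big_cons.
case: (boolP (P i)) => [Pi|_]; last exact: IH.
by move=> x; apply: cvgD; [exact: cF|exact: IH].
Qed.

(** Serves [linear_sups_le]: the coefficients [c] certify a pointwise inequality in a form that
    still makes sense in a vector lattice, where there are no points. *)
Lemma gordan n m (b : 'I_m -> 'I_n -> R) :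
  (0 < m)%N ->
  (forall x : 'I_n -> R, exists k, 0 <= \sum_j b k j * x j) ->
  exists c : 'I_m -> R, [/\ forall k, 0 <= c k, \sum_k c k = 1 &
    forall j, \sum_k c k * b k j = 0].
Proof.
move=> m0 bx.
pose A : set 'rV[R]_m :=
  [set c | forall i, `[0, 1]%classic (c ord0 i)] `&`
  [set c | \sum_k c ord0 k = 1].
pose p (c : 'rV[R]_m) j := \sum_k c ord0 k * b k j.
(* The point of the convex hull closest to 0: if it is nonzero, moving towards a
   vertex with a nonpositive product would decrease [F]. *)
pose F c := \sum_j p c j ^+ 2.
have cA : compact A.
  apply: compact_closedI.
    have := @rV_compact R m (fun=> `[0, 1]%classic).
    by apply => i; exact: segment_compact.
  apply: (@closed_comp _ _ (fun c : 'rV[R]_m => \sum_k c ord0 k) [set 1]).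
    by move=> c _; apply: continuous_sum_fun => k _; exact: coord_continuous.
  exact: closed_eq.
have cF : continuous F.
  apply: continuous_sum_fun => j _ c; apply: continuousM;
    apply: (@continuous_sum_fun _ _ _ _ (fun k (c : 'rV[R]_m) => c ord0 k * b k j)) => k _;
    by move=> d; apply: continuousM; [exact: coord_continuous|exact: cst_continuous].
have mem (c : 'rV[R]_m) : (forall k, 0 <= c ord0 k) -> \sum_k c ord0 k = 1 -> A c.
  move=> c0 c1; split => //= i; rewrite /= in_itv /= c0 /= -c1 (bigD1 i) //=.
  by rewrite lerDl; apply: sumr_ge0.
have [c] : exists2 c, c \in A & forall t, t \in A -> F c <= F t.
  apply: compact_EVT_min => //; last exact: continuous_subspaceT.
  exists (delta_mx ord0 (Ordinal m0)); apply: mem.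
    by move=> k; rewrite mxE; case: (_ && _).
  rewrite (bigD1 (Ordinal m0)) //= mxE !eqxx big1 ?addr0 // => i /negbTE ni.
  by rewrite mxE ni.
rewrite inE => -[/= c01 c1] cmin.
have {c01} c0 k : 0 <= c ord0 k by have := c01 k; rewrite /= in_itv /= => /andP[].
exists (c ord0); split => // j.
(* By [e0], vertex [k] has a nonpositive product with [p c], so [d] points downhill for [F]. *)
have [k] := bx (fun j => - p c j).
set e := \sum_j _ => e0.
pose d j := b k j - p c j.
have pF t : 0 <= t <= 1 ->
    0 <= t * (t * (\sum_j d j ^+ 2) - 2 * (e + F c)).
  move=> /andP[t0 t1].
  pose ct := (1 - t) *: c + t *: delta_mx ord0 k.
  have ctE i : ct ord0 i = (1 - t) * c ord0 i + t * (i == k)%:R.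
    by rewrite !mxE eqxx.
  have : F c <= F ct.
    apply: cmin; rewrite inE; apply: mem => [i|].
      by rewrite ctE addr_ge0 // mulr_ge0 // subr_ge0.
    under eq_bigr do rewrite ctE.
    rewrite big_split /= -!mulr_sumr c1 (bigD1 k) //= eqxx mulr1n big1 => [|i /negbTE -> //].
    by ring.
  have pct i : p ct i = p c i + t * d i.
    rewrite /p; under eq_bigr do rewrite ctE mulrDl -!mulrA.
    rewrite big_split /= -!mulr_sumr [X in _ + _ * X](bigD1 k) //= eqxx mulr1n.
    rewrite [X in _ + t * (_ + X)]big1 => [|l /negbTE ->]; last by rewrite mul0r.
    by rewrite /d /p; ring.
  rewrite -subr_ge0; congr (_ <= _).
  rewrite /F /e -sumrB mulrBr [t * (2 * _)]mulrCA -big_split /= !mulr_sumr -sumrB.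
  by apply: eq_bigr => i _; rewrite pct /d; ring.
have F0 : 0 <= F c by apply: sumr_ge0 => i _; exact: sqr_ge0.
have D0 : 0 <= \sum_j d j ^+ 2 by apply: sumr_ge0 => i _; exact: sqr_ge0.
have FE : F c = 0.
  apply/eqP; rewrite eq_le F0 andbT leNgt; apply/negP => Fp.
  set D := \sum_j d j ^+ 2 in pF D0.
  (* At most 1, so the moved point stays in the simplex, and small enough that [t * D <= F c], which
     contradicts [pF] because [e] is nonnegative. *)
  pose t := F c / (F c + D).
  have FD : 0 < F c + D by rewrite ltr_wpDr.
  have t0 : 0 < t by rewrite divr_gt0.
  have := pF t; rewrite ltW //= /t ler_pdivrMr // mul1r lerDl D0 => /(_ isT).
  rewrite -/t pmulr_rge0 // => h.
  have : t * D <= F c.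
    by rewrite /t mulrAC ler_pdivrMr // ler_wpM2l // lerDr.
  lra.
have /eqP : p c j ^+ 2 = 0.
  apply/eqP; rewrite eq_le sqr_ge0 andbT -FE /F (bigD1 j) //= lerDl.
  by apply: sumr_ge0 => i _; exact: sqr_ge0.
by rewrite sqrf_eq0 => /eqP.
Qed.

End gordan.

(** * Piecewise-linear functions and their values in a vector lattice *)

Section piecewise_linear.
Context {R : realType} {n : nat} {E : banachLatticeType R}.
Implicit Types (f g : 'rV[R]_n -> R) (v : 'I_n -> E) (u w : E).

(** Evaluates one lattice-linear expression both on R^n and at [v]. It is a relation because many
    expressions denote the same function; [pl_le] and antisymmetry show that the value depends on
    the function alone. *)
Inductive pl v : ('rV[R]_n -> R) -> E -> Prop :=
| pl_zero : pl v (fun=> 0) 0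
| pl_coord j : pl v (fun x => x ord0 j) (v j)
| pl_lin a f g u w : pl v f u -> pl v g w ->
    pl v (fun x => a * f x + g x) (a *: u + w)
| pl_max f g u w : pl v f u -> pl v g w ->
    pl v (fun x => Num.max (f x) (g x)) (vjoin u w).

(** The suprema are given by their universal properties, since an iterated join in [E] has no bottom
    element to start from. The same forms [A] serve on R^n and in [E]. *)
Definition linear_sups v f w := exists (I : finType) (A : I -> 'I_n -> R),
  (forall x z, f x <= z <-> forall i, \sum_j A i j * x ord0 j <= z) /\
  (forall z, vle w z <-> forall i, vle (\sum_j A i j *: v j) z).

Lemma linear_sups_add v f g u w : linear_sups v f u -> linear_sups v g w ->
  linear_sups v (fun x => f x + g x) (u + w).
Proof.
move=> [I [A [fA uA]]] [J [B [gB wB]]].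
exists (I * J)%type, (fun p j => A p.1 j + B p.2 j); split.
  move=> x z; split=> [fgz [i j] /=|h].
    under eq_bigr do rewrite mulrDl.
    rewrite big_split /=; apply: le_trans fgz; apply: lerD.
      by apply: (fA x (f x)).1.
    by apply: (gB x (g x)).1.
  rewrite -lerBrDr; apply/fA => i; rewrite lerBrDr addrC -lerBrDr.
  apply/gB => j; rewrite lerBrDr addrC.
  have := h (i, j); apply: le_trans; rewrite -big_split /=.
  by apply: ler_sum => k _; rewrite mulrDl.
move=> z; split=> [uwz [i j] /=|h].
  under eq_bigr do rewrite scalerDl.
  rewrite big_split /=; apply: vle_trans uwz; apply: vleD.
    by apply: (uA u).1; exact: vle_refl.
  by apply: (wB w).1; exact: vle_refl.
have sub a b c : vle (a + b) c <-> vle a (c - b).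
  by rewrite -[X in _ <-> X](vle_add2r b) subrK.
rewrite sub; apply/uA => i; rewrite -sub addrC sub.
apply/wB => j; rewrite -sub addrC.
have := h (i, j); apply: vle_trans; rewrite -big_split /=.
under [X in vle _ X]eq_bigr do rewrite scalerDl.
exact: vle_refl.
Qed.

Lemma linear_sups_scale v a f u : 0 < a -> linear_sups v f u ->
  linear_sups v (fun x => a * f x) (a *: u).
Proof.
move=> a0 [I [A [fA uA]]]; exists I, (fun i j => a * A i j); split.
  move=> x z; rewrite -ler_pdivlMl //; split.
    move=> /fA h i; rewrite (eq_bigr (fun j => a * (A i j * x ord0 j))).
      by rewrite -mulr_sumr -ler_pdivlMl.
    by move=> j _; rewrite mulrA.
  move=> h; apply/fA => i; rewrite ler_pdivlMl // mulr_sumr.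
  by have := h i; under eq_bigr do rewrite -mulrA.
have scal (y z : E) : vle (a *: y) z <-> vle y (a^-1 *: z).
  split=> [|] h.
    rewrite -[y](scalerK (lt0r_neq0 a0)).
    by apply: vle_scale => //; rewrite invr_ge0 ltW.
  by rewrite -[z](scalerKV (lt0r_neq0 a0)); apply: vle_scale; rewrite ?ltW.
have sumE i : \sum_j (a * A i j) *: v j = a *: \sum_j A i j *: v j.
  by rewrite scaler_sumr; apply: eq_bigr => j _; rewrite scalerA.
by move=> z; rewrite scal uA; split=> h i; have := h i; rewrite sumE scal.
Qed.

Lemma linear_sups_max v f g u w : linear_sups v f u -> linear_sups v g w ->
  linear_sups v (fun x => Num.max (f x) (g x)) (vjoin u w).
Proof.
move=> [I [A [fA uA]]] [J [B [gB wB]]].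
exists (I + J)%type, (fun p => match p with inl i => A i | inr j => B j end).
split=> [x z|z].
  rewrite ge_max; split=> [/andP[/fA h1 /gB h2] [i|j]|h].
  - exact: h1.
  - exact: h2.
  - by apply/andP; split; [apply/fA => i; exact: (h (inl i))|
                           apply/gB => j; exact: (h (inr j))].
rewrite vjoinP; split=> [[/uA h1 /wB h2] [i|j]|h].
- exact: h1.
- exact: h2.
- by split; [apply/uA => i; exact: (h (inl i))|apply/wB => j; exact: (h (inr j))].
Qed.

Lemma linear_sups_single v (a : 'I_n -> R) :
  linear_sups v (fun x => \sum_j a j * x ord0 j) (\sum_j a j *: v j).
Proof.
by exists unit, (fun=> a); split=> [x z|z]; split=> // h; exact: (h tt).
Qed.

(** Each form [A i] lies below the maximum of the forms [B k], so Gordan's theorem applied to the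
    differences [B k - A i] writes [A i] as a convex combination of the [B k]. At [v], each [B k] is
    below [w], hence so is the combination. *)
Lemma linear_sups_le v f g u w : linear_sups v f u -> linear_sups v g w ->
  (forall x, f x <= g x) -> vle u w.
Proof.
move=> [I [A [fA uA]]] [J [B [gB wB]]] fg; apply/uA => i.
(* With [J] empty, every number would bound [g 0], including [g 0 - 1]. *)
have [k0] : exists k0 : J, true.
  apply/existsP; rewrite -[[exists _, _]]negbK; apply/negP => /existsPn J0.
  have : g 0 <= g 0 - 1 by apply/gB => k; have := J0 k.
  by rewrite lerBrDl gerDr ler10.
move=> _.
have J0 : (0 < #|J|)%N by apply/card_gt0P; exists k0.
have [] := @gordan R n #|J| (fun k j => B (enum_val k) j - A i j) J0.
  move=> x; pose y : 'rV[R]_n := \row_j x j.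
  have [k _ kmax] := @Order.TotalTheory.arg_maxP _ _ J k0 xpredT
                       (fun k => \sum_j B k j * x j) isT.
  exists (enum_rank k); under eq_bigr do rewrite enum_rankK mulrBl.
  rewrite sumrB subr_ge0.
  have : \sum_j A i j * y ord0 j <= g y by apply: le_trans (fg y); exact: (fA y _).1.
  under eq_bigr do rewrite mxE.
  move=> /le_trans; apply; apply/gB => k'.
  by under eq_bigr do rewrite mxE; exact: kmax.
move=> c [c0 c1 cB].
have -> : \sum_j A i j *: v j =
    \sum_k c k *: (\sum_j B (enum_val k) j *: v j).
  under [RHS]eq_bigr do rewrite scaler_sumr.
  rewrite exchange_big /=; apply: eq_bigr => j _.
  under [RHS]eq_bigr do rewrite scalerA.
  rewrite -scaler_suml; congr (_ *: _); apply/esym/eqP.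
  rewrite -subr_eq0 -[X in _ - X]mul1r -c1 mulr_suml -sumrB -[X in _ == X](cB j).
  by apply/eqP; apply: eq_bigr => k _; rewrite mulrBr.
rewrite -[w]scale1r -c1 scaler_suml; apply: vle_sum => k _.
by apply: vle_scale => //; exact: (wB w).1 (vle_refl _) _.
Qed.

(** A negative scalar exchanges the two suprema, and a maximum is absorbed by max (g1 - h1, g2 - h2)
    = max (g1 + h2, g2 + h1) - (h1 + h2), an identity that also holds in [E]. *)
Lemma pl_normal_form v f w : pl v f w -> exists g h u t,
  [/\ linear_sups v g u, linear_sups v h t, f = (fun x => g x - h x) & w = u - t].
Proof.
have zero : linear_sups v (fun=> 0) 0.
  have := linear_sups_single v (fun=> 0).
  rewrite big1 => [|j _]; last by rewrite scale0r.
  congr linear_sups; apply/funext => x.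
  by rewrite big1 // => j _; rewrite mul0r.
elim=> {f w}.
- exists (fun=> 0), (fun=> 0), 0, 0; by split=> //; rewrite subr0.
- move=> j; exists (fun x => x ord0 j), (fun=> 0), (v j), 0; split=> //.
  + have := linear_sups_single v (fun k => (k == j)%:R).
    rewrite (bigD1 j) //= eqxx scale1r big1 ?addr0 => [|k /negbTE ->];
      last by rewrite scale0r.
    congr linear_sups; apply/funext => x.
    rewrite (bigD1 j) //= eqxx mul1r big1 ?addr0 // => k /negbTE ->.
    by rewrite mul0r.
  + by apply/funext => x; rewrite subr0.
  + by rewrite subr0.
- move=> a f g u w _ [g1 [h1 [u1 [t1 [gu1 ht1 -> ->]]]]].
  move=> _ [g2 [h2 [u2 [t2 [gu2 ht2 -> ->]]]]].
  have [a0|a0|->] := ltgtP a 0.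
  + exists (fun x => (- a) * h1 x + g2 x), (fun x => (- a) * g1 x + h2 x).
    exists ((- a) *: t1 + u2), ((- a) *: u1 + t2); split.
    * by apply: linear_sups_add => //; apply: linear_sups_scale; rewrite ?oppr_gt0.
    * by apply: linear_sups_add => //; apply: linear_sups_scale; rewrite ?oppr_gt0.
    * by apply/funext => x; ring.
    * by rewrite !scaleNr scalerBr opprD opprK [RHS]addrACA [- (a *: t1) + _]addrC.
  + exists (fun x => a * g1 x + g2 x), (fun x => a * h1 x + h2 x).
    exists (a *: u1 + u2), (a *: t1 + t2); split.
    * by apply: linear_sups_add => //; exact: linear_sups_scale.
    * by apply: linear_sups_add => //; exact: linear_sups_scale.
    * by apply/funext => x; ring.
    * by rewrite scalerBr opprD addrACA.
  + exists g2, h2, u2, t2; split=> //; last by rewrite scale0r add0r.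
    by apply/funext => x; ring.
- move=> f g u w _ [g1 [h1 [u1 [t1 [gu1 ht1 -> ->]]]]].
  move=> _ [g2 [h2 [u2 [t2 [gu2 ht2 -> ->]]]]].
  exists (fun x => Num.max (g1 x + h2 x) (g2 x + h1 x)), (fun x => h1 x + h2 x).
  exists (vjoin (u1 + t2) (u2 + t1)), (t1 + t2); split.
  + by apply: linear_sups_max; apply: linear_sups_add.
  + exact: linear_sups_add.
  + apply/funext => x; rewrite addr_maxl; congr Num.max; ring.
  + rewrite vjoinDr; congr vjoin.
      by rewrite [t1 + t2]addrC opprD addrA addrK.
    by rewrite opprD addrA addrK.
Qed.

Lemma pl_le v f g u w : pl v f u -> pl v g w ->
  (forall x, f x <= g x) -> vle u w.
Proof.
move=> /pl_normal_form[g1 [h1 [u1 [t1 [gu1 ht1 -> ->]]]]].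
move=> /pl_normal_form[g2 [h2 [u2 [t2 [gu2 ht2 -> ->]]]]] fg.
have : vle (u1 + t2) (u2 + t1).
  apply: (linear_sups_le (linear_sups_add gu1 ht2) (linear_sups_add gu2 ht1)).
  by move=> x; have := fg x; lra.
rewrite -(vle_add2r (- t1 - t2)); congr vle.
  by rewrite [- t1 - t2]addrC addrA addrK.
by rewrite addrA addrK.
Qed.

Lemma pl_congr v f g u w : pl v f u -> f =1 g -> u = w -> pl v g w.
Proof. by move=> fu /funext <- <-. Qed.

Lemma pl_add v f g u w : pl v f u -> pl v g w ->
  pl v (fun x => f x + g x) (u + w).
Proof.
move=> fu gw; apply: (pl_congr (pl_lin 1 fu gw)) => [x|].
  by rewrite mul1r.
by rewrite scale1r.
Qed.

Lemma pl_scale v a f u : pl v f u -> pl v (fun x => a * f x) (a *: u).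
Proof.
move=> fu; apply: (pl_congr (pl_lin a fu (pl_zero v))) => [x|]; by rewrite addr0.
Qed.

Lemma pl_opp v f u : pl v f u -> pl v (fun x => - f x) (- u).
Proof.
move=> fu; apply: (pl_congr (pl_scale (- 1) fu)) => [x|].
  by rewrite mulN1r.
by rewrite scaleN1r.
Qed.

Lemma pl_min v f g u w : pl v f u -> pl v g w ->
  pl v (fun x => Num.min (f x) (g x)) (vmeet u w).
Proof.
move=> fu gw; apply: (pl_congr (pl_opp (pl_max (pl_opp fu) (pl_opp gw)))) => //.
by move=> x; rewrite oppr_max !opprK.
Qed.

Lemma pl_abs v f u : pl v f u -> pl v (fun x => `|f x|) (vabs u).
Proof.
move=> fu; apply: (pl_congr (pl_max fu (pl_opp fu))) => // x.
by case: (lerP 0 (f x)) => h; [rewrite ger0_norm ?max_l|rewrite ltr0_norm ?max_r]; lra.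
Qed.

Lemma pl_sum v (I : Type) (r : seq I) (F : I -> 'rV[R]_n -> R) (U : I -> E) :
  (forall i, pl v (F i) (U i)) ->
  pl v (fun x => \sum_(i <- r) F i x) (\sum_(i <- r) U i).
Proof.
move=> FU; elim: r => [|i r IH].
  by apply: (pl_congr (pl_zero v)) => [x|]; rewrite big_nil.
by apply: (pl_congr (pl_add (FU i) IH)) => [x|]; rewrite big_cons.
Qed.

End piecewise_linear.

Section limits.
Context {R : realType}.

Lemma harmonic_lt (d e : R) : 0 < e ->
  exists K, forall k, (K <= k)%N -> d / k.+1%:R < e.
Proof.
move=> e0; exists (Num.truncn (`|d| / e)) => k Kk.
rewrite ltr_pdivrMr ?ltr0n // mulrC -ltr_pdivrMr //.
apply: (@le_lt_trans _ _ (`|d| / e)).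
  by rewrite ler_pdivrMr // divfK ?gt_eqF // ler_norm.
apply: lt_le_trans (truncnS_gt _) _.
by rewrite ler_nat ltnS.
Qed.

(** Stated for complete pseudometric spaces because it produces limits both in Banach lattices and
    in the target [X]. The factor 2 leaves room for passing to the limit with open balls. *)
Lemma harmonic_limit (T : completePseudoMetricType R) (u : nat -> T) (d : R) :
  0 < d ->
  (forall k l, ball (u k) (d / k.+1%:R + d / l.+1%:R) (u l)) ->
  exists w, forall k, ball (u k) (2 * (d / k.+1%:R)) w.
Proof.
move=> d0 ud.
have e0 k : 0 < d / k.+1%:R by rewrite divr_gt0 ?ltr0n.
have : cauchy (u @ \oo).
  apply: cauchy_exP => eps eps0.
  have eps20 : 0 < eps / 2 by rewrite divr_gt0.
  have [K hK] := harmonic_lt d eps20.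
  exists (u K); exists K => // l Kl.
  apply: le_ball (ud K l).
  by rewrite [leRHS]splitr lerD // ltW // hK.
move=> /cauchy_cvg /cvg_ex[w uw]; exists w => k.
have [K hK] := harmonic_lt d (divr_gt0 (e0 k) (ltr0n R 2)).
have /cvg_ballP /(_ _ (divr_gt0 (e0 k) (ltr0n R 2))) [L _ hL] := uw.
have /= := hL (maxn K L) (leq_maxr _ _).
move=> /ball_sym /(ball_triangle (ud k (maxn K L))); apply: le_ball.
have := hK (maxn K L) (leq_maxl _ _).
move: (d / _) (d / _) => a b; lra.
Qed.

End limits.

Section continuous_functions.
Context {R : realType} {T : topologicalType}.
Implicit Types f g : T -> R.

Lemma continuous_lin a f g : continuous f -> continuous g ->
  continuous (fun x => a * f x + g x).
Proof.
move=> cf cg x; apply: (cvgD _ (cg x)).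
by apply: cvgM; [exact: cvg_cst|exact: cf].
Qed.

Lemma continuous_abs f : continuous f -> continuous (fun x => `|f x|).
Proof. by move=> cf x; apply: cvg_norm; exact: cf. Qed.

Lemma continuous_add f g : continuous f -> continuous g ->
  continuous (fun x => f x + g x).
Proof. by move=> cf cg x; apply: cvgD; [exact: cf|exact: cg]. Qed.

Lemma continuous_sub f g : continuous f -> continuous g ->
  continuous (fun x => f x - g x).
Proof. by move=> cf cg x; apply: cvgB; [exact: cf|exact: cg]. Qed.

End continuous_functions.

(** * Positively homogeneous functions and the l^1 sphere *)

Section positively_homogeneous.
Context {R : realType} {n : nat}.
Implicit Types (f g : 'rV[R]_n -> R).

Lemma krivine_fun_coord j : krivine_fun (fun x : 'rV[R]_n => x ord0 j).
Proof. by split=> [|t x _]; [exact: coord_continuous|rewrite mxE]. Qed.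

Lemma krivine_fun0 : krivine_fun (fun _ : 'rV[R]_n => 0 : R).
Proof. by split=> [|t x _]; [exact: cst_continuous|rewrite mulr0]. Qed.

Lemma krivine_fun_lin a f g : krivine_fun f -> krivine_fun g ->
  krivine_fun (fun x => a * f x + g x).
Proof.
move=> [cf hf] [cg hg]; split=> [|t x t0]; first exact: continuous_lin.
by rewrite hf // hg //; ring.
Qed.

Lemma krivine_fun_add f g : krivine_fun f -> krivine_fun g ->
  krivine_fun (fun x => f x + g x).
Proof.
move=> kf kg; have := krivine_fun_lin 1 kf kg.
by under eq_fun do rewrite mul1r.
Qed.

Lemma krivine_fun_scale a f : krivine_fun f -> krivine_fun (fun x => a * f x).
Proof.
move=> kf; have := krivine_fun_lin a kf krivine_fun0.
by under eq_fun do rewrite addr0.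
Qed.

Lemma krivine_fun_opp f : krivine_fun f -> krivine_fun (fun x => - f x).
Proof.
move=> kf; have := krivine_fun_scale (-1) kf.
by under eq_fun do rewrite mulN1r.
Qed.

Lemma krivine_fun_sub f g : krivine_fun f -> krivine_fun g ->
  krivine_fun (fun x => f x - g x).
Proof. by move=> kf kg; exact/krivine_fun_add/krivine_fun_opp. Qed.

Lemma krivine_fun_abs f : krivine_fun f -> krivine_fun (fun x => `|f x|).
Proof.
move=> [cf hf]; split=> [|t x t0]; first exact: continuous_abs.
by rewrite hf // normrM ger0_norm.
Qed.

Lemma krivine_fun_max f g : krivine_fun f -> krivine_fun g ->
  krivine_fun (fun x => Num.max (f x) (g x)).
Proof.
move=> kf kg.
have := krivine_fun_scale 2^-1 (krivine_fun_add (krivine_fun_add kf kg)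
  (krivine_fun_abs (krivine_fun_sub kf kg))).
by congr krivine_fun; apply/funext => x; rewrite maxr_absE mulrC.
Qed.

Lemma krivine_fun_min f g : krivine_fun f -> krivine_fun g ->
  krivine_fun (fun x => Num.min (f x) (g x)).
Proof.
move=> kf kg.
have := krivine_fun_opp (krivine_fun_max (krivine_fun_opp kf) (krivine_fun_opp kg)).
by congr krivine_fun; apply/funext => x; rewrite oppr_max !opprK.
Qed.

Lemma krivine_fun_sum (I : Type) (r : seq I) (P : pred I)
    (F : I -> 'rV[R]_n -> R) :
  (forall i, P i -> krivine_fun (F i)) ->
  krivine_fun (fun x => \sum_(i <- r | P i) F i x).
Proof.
move=> kF; split=> [|t x t0].
  by apply: continuous_sum_fun => i Pi; case: (kF i Pi).
by rewrite mulr_sumr; apply: eq_bigr => i Pi; case: (kF i Pi) => _ ->.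
Qed.

Definition l1norm (x : 'rV[R]_n) : R := \sum_j `|x ord0 j|.

Lemma krivine_fun_l1norm : krivine_fun l1norm.
Proof.
by apply: krivine_fun_sum => j _; exact/krivine_fun_abs/krivine_fun_coord.
Qed.

Lemma l1norm_ge0 x : 0 <= l1norm x.
Proof. exact: sumr_ge0. Qed.

Lemma norm_le_l1norm x : `|x| <= l1norm x.
Proof.
rewrite /Num.norm /= mx_normrE; apply: bigmax_le => [|[i j] _ /=].
  exact: l1norm_ge0.
by rewrite (ord1 i) /l1norm (bigD1 j) //= lerDl; exact: sumr_ge0.
Qed.

Lemma l1norm_eq0 x : l1norm x = 0 -> x = 0.
Proof.
by move=> x0; apply/normr0_eq0/eqP; rewrite eq_le normr_ge0 andbT -x0 norm_le_l1norm.
Qed.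

Lemma l1normZ a x : l1norm (a *: x) = `|a| * l1norm x.
Proof.
by rewrite /l1norm mulr_sumr; apply: eq_bigr => j _; rewrite mxE normrM.
Qed.

Definition l1sphere : set 'rV[R]_n := [set x | l1norm x = 1].

Lemma l1sphere_compact : compact l1sphere.
Proof.
apply: bounded_closed_compact.
  exists 1; split=> [|M M1 x /= Sx]; first exact: real1.
  by apply: le_trans (norm_le_l1norm x) _; rewrite Sx ltW.
apply: (@closed_comp _ _ l1norm [set 1]); last exact: closed_eq.
by move=> x _; case: krivine_fun_l1norm => + _; exact.
Qed.

Lemma l1sphere_scale x : l1norm x != 0 ->
  exists2 y, l1sphere y & x = l1norm x *: y.
Proof.
move=> x0; exists ((l1norm x)^-1 *: x); last by rewrite scalerA mulfV // scale1r.
rewrite /l1sphere /= l1normZ ger0_norm ?invr_ge0 ?l1norm_ge0 //.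
by rewrite mulVf.
Qed.

(** Homogeneity makes both functions vanish at 0 and carries the inequality from the sphere along
    each ray. *)
Lemma krivine_fun_le f g : krivine_fun f -> krivine_fun g ->
  (forall y, l1sphere y -> f y <= g y) -> forall x, f x <= g x.
Proof.
move=> [_ hf] [_ hg] fg x; have [x0|/l1sphere_scale[y Sy ->]] := eqVneq (l1norm x) 0.
  by rewrite (l1norm_eq0 x0) -(scale0r 0) hf // hg // !mul0r.
by rewrite hf ?l1norm_ge0 // hg ?l1norm_ge0 // ler_wpM2l ?l1norm_ge0 // fg.
Qed.

End positively_homogeneous.

(** The open sets where [g y] lies below [f] cover [S], each containing its own index [y]; a finite
    subcover gives [ys]. *)
Lemma compact_selection (R : realType) (T : ptopologicalType) (S : set T)
    (f : T -> R) (g : T -> T -> R) :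
  compact S -> continuous f -> (forall y, continuous (g y)) ->
  (forall y, S y -> g y y < f y) ->
  exists2 ys : seq T, (forall y, y \in ys -> S y) &
    forall x, S x -> exists2 y, y \in ys & g y x < f x.
Proof.
move=> cS cf cg gf.
pose U y := [set x | 0 < f x - g y x].
have oU y : S y -> open (U y).
  move=> _; apply: (@open_comp _ _ (fun x => f x - g y x) [set z | 0 < z]).
    by move=> x _; apply: continuous_sub.
  exact: open_gt.
have [D DS cD] : finite_subset_cover S U S.
  have : cover_compact S by rewrite -compact_cover.
  apply => // x Sx; exists x => //; rewrite /U /= subr_gt0; exact: gf.
exists (finmap.enum_fset D) => [y yD|x /cD [y /= yD]].
  by have := DS y yD; rewrite inE.
by rewrite /U /= subr_gt0 => h; exists y.
Qed.

(** * Existence and uniqueness of the functional calculus *)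

Section krivine_calculus.
Context {R : realType} {n : nat} {E : banachLatticeType R}.
Implicit Types (f g : 'rV[R]_n -> R) (v : 'I_n -> E) (u w : E).

Lemma pl_krivine_fun v f w : pl v f w -> krivine_fun f.
Proof.
elim=> {f w} [|j|a f g u w _ kf _ kg|f g u w _ kf _ kg].
- exact: krivine_fun0.
- exact: krivine_fun_coord.
- exact: krivine_fun_lin.
- exact: krivine_fun_max.
Qed.

Definition vl1 v : E := \sum_j vabs (v j).

Lemma pl_l1norm v : pl v l1norm (vl1 v).
Proof. by apply: pl_sum => j; apply: pl_abs; exact: pl_coord. Qed.

(** [vl1 v] is the lattice counterpart of [l1norm]: uniform closeness on the l^1 sphere becomes
    order closeness relative to it, hence norm closeness. *)
Lemma pl_dist v f g u w c : pl v f u -> pl v g w ->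
  (forall x, `|f x - g x| <= c * l1norm x) -> vle (vabs (u - w)) (c *: vl1 v).
Proof.
move=> fu gw fg.
have fgu : pl v (fun x => f x - g x) (u - w).
  by apply: pl_add => //; exact: pl_opp.
exact: (pl_le (pl_abs fgu) (pl_scale c (pl_l1norm v)) fg).
Qed.

Lemma pl_min_seq v (T : eqType) (g : T -> 'rV[R]_n -> R) (U : T -> E) y0 ys :
  (forall y, pl v (g y) (U y)) -> exists G W, pl v G W /\
  forall x, (exists2 y, y \in y0 :: ys & G x = g y x) /\
    forall y, y \in y0 :: ys -> G x <= g y x.
Proof.
move=> gU; elim: ys y0 => [|y1 ys IH] y0.
  exists (g y0), (U y0); split=> // x; split.
    by exists y0; rewrite ?mem_head.
  by move=> y; rewrite inE => /eqP ->.
have [G [W [GW h]]] := IH y1.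
exists (fun x => Num.min (g y0 x) (G x)), (vmeet (U y0) W).
split; first exact: pl_min.
move=> x; have [[y yin Gy] Gmin] := h x; split.
  case: (leP (g y0 x) (G x)) => _; first by exists y0; rewrite ?mem_head.
  by exists y => //; rewrite inE yin orbT.
move=> z; rewrite inE => /predU1P[->|zin]; first by rewrite ge_min lexx.
by rewrite ge_min Gmin ?orbT.
Qed.

(* McShane's formula: [f] is the lower envelope of the piecewise-linear cones
   [(f y + e) * l1norm x + K y * l1norm (x - l1norm x *: y)]; finitely many
   of them suffice by compactness of the sphere. *)
Lemma pl_dense v f e : krivine_fun f -> 0 < e ->
  exists g u, pl v g u /\ forall x, `|f x - g x| <= e * l1norm x.
Proof.
move=> kf e0; have [cf hf] := kf.
have [M M0 fM] : exists2 M, 0 < M & forall x, l1sphere x -> `|f x| <= M.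
  have : bounded_set (f @` l1sphere).
    apply/compact_bounded/continuous_compact; last exact: l1sphere_compact.
    exact: continuous_subspaceT.
  move=> /ex_strict_bound_gt0[M M0 h]; exists M => // x Sx.
  by apply/ltW/h; exists x.
pose e1 := e / 3; have e10 : 0 < e1 by rewrite divr_gt0.
have near_f y : exists K, 0 <= K /\ forall x, l1sphere x -> l1sphere y ->
    f x <= f y + e1 + K * l1norm (x - y).
  have /cvgrPdist_lt /(_ e1 e10) /nbhs_ballP[d /= d0 hd] := cf y.
  (* Within distance [d] of [y] continuity suffices; from there on this slope has lifted the cone by
     at least [2 * M], the largest possible oscillation of [f] on the sphere. *)
  exists (2 * M / d); split; first by rewrite divr_ge0 ?mulr_ge0 ?ltW.
  move=> x Sx Sy; have [xyd|dxy] := ltP (l1norm (x - y)) d.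
    apply: (@le_trans _ _ (f y + e1)); last first.
      by rewrite lerDl mulr_ge0 ?l1norm_ge0 // divr_ge0 ?mulr_ge0 ?ltW.
    have : `|f y - f x| < e1.
      apply: hd; rewrite -ball_normE /=; apply: le_lt_trans xyd.
      by rewrite distrC norm_le_l1norm.
    by rewrite ltr_norml => /andP[+ _]; rewrite ltrBrDr => h; lra.
  apply: (@le_trans _ _ (f y + 2 * M)).
    have := fM x Sx; have := fM y Sy; rewrite !ler_norml => /andP[? ?] /andP[? ?].
    lra.
  apply: lerD; first by rewrite lerDl ltW.
  by rewrite mulrAC ler_pdivlMr // ler_wpM2l // mulr_ge0 // ltW.
have /boolp.choice[K KP] := near_f.
pose cone y x := (f y + e1) * l1norm x +
  K y * \sum_j `|x ord0 j + - y ord0 j * l1norm x|.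
have coneU y : exists u, pl v (cone y) u.
  exists ((f y + e1) *: vl1 v +
          K y *: \sum_j vabs (v j + (- y ord0 j) *: vl1 v)).
  apply: pl_add; first exact/pl_scale/pl_l1norm.
  apply: pl_scale; apply: pl_sum => j; apply: pl_abs.
  by apply: pl_add; [exact: pl_coord|exact/pl_scale/pl_l1norm].
have /boolp.choice[U UP] := coneU.
have cone_sphere y x : l1sphere x ->
    cone y x = f y + e1 + K y * l1norm (x - y).
  move=> Sx; rewrite /cone Sx mulr1; congr (_ + _ * _).
  by apply: eq_bigr => j _; rewrite !mxE mulr1.
have [ys ysS ysP] : exists2 ys : seq 'rV[R]_n, (forall y, y \in ys -> l1sphere y) &
    forall x, l1sphere x -> exists2 y, y \in ys & cone y x < f x + e.
  apply: compact_selection.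
  - exact: l1sphere_compact.
  - by apply: continuous_add => //; exact: cst_continuous.
  - by move=> y; have [] := pl_krivine_fun (UP y).
  - move=> y Sy; rewrite cone_sphere // subrr (_ : l1norm 0 = 0).
      by rewrite /e1; lra.
    by rewrite -(scale0r 0) l1normZ normr0 mul0r.
have [G [W [GW GP]]] : exists G W, pl v G W /\
    forall x, l1sphere x -> f x - e * l1norm x <= G x <= f x + e * l1norm x.
  case: ys ysS ysP => [|y0 ys] ysS ysP.
    exists (fun=> 0), 0; split; first exact: pl_zero.
    by move=> x /ysP[y].
  have [G [W [GW GP]]] := pl_min_seq y0 ys UP.
  exists G, W; split => // x Sx; have [[y yin Gy] Gmin] := GP x.
  rewrite Sx mulr1; apply/andP; split.
    rewrite Gy cone_sphere //.
    have := (KP y).2 x Sx (ysS y yin).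
    move=> h; apply: le_trans h; lra.
  by have [z zin /ltW] := ysP x Sx; apply: le_trans; exact: Gmin.
exists G, W; split => // x.
have kG := pl_krivine_fun GW.
have kN := krivine_fun_scale e (@krivine_fun_l1norm R n).
rewrite ler_distlC; apply/andP; split.
  have := krivine_fun_le (krivine_fun_sub kf kN) kG.
  by apply => y /GP /andP[].
have := krivine_fun_le kG (krivine_fun_add kf kN).
by apply => y /GP /andP[].
Qed.

(** The graph of the calculus, built by approximation: [pl_limit_exists] and [pl_limit_unique] make
    it a function on [krivine_fun]. *)
Definition pl_limit v f w := forall e, 0 < e -> exists g u,
  [/\ pl v g u, forall x, `|f x - g x| <= e * l1norm x & `|w - u| <= e].

Lemma pl_limit_pl v f w : pl v f w -> pl_limit v f w.
Proof.
move=> fw e e0; exists f, w; split=> // [x|]; last by rewrite subrr normr0 ltW.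
by rewrite subrr normr0 mulr_ge0 ?l1norm_ge0 // ltW.
Qed.

Lemma pl_limit_unique v f w w' : pl_limit v f w -> pl_limit v f w' -> w = w'.
Proof.
move=> fw fw'; apply/eqP; rewrite -subr_eq0 -normr_eq0 eq_le normr_ge0 andbT.
apply/ler_addgt0Pl => e e0; rewrite addr0.
(* Two errors [d] come from replacing [w] and [w'] by approximants; the approximants differ by at
   most [2 * d * c], by [pl_dist]. *)
pose c := `|vl1 v|; pose d := e / (2 + 2 * c).
have c0 : 0 < 2 + 2 * c by rewrite ltr_pwDl // mulr_ge0 // normr_ge0.
have d0 : 0 < d by rewrite divr_gt0.
have : d * (2 + 2 * c) = e by rewrite divfK ?gt_eqF.
clearbody d => de.
have [g [u [gu fg wu]]] := fw d d0.
have [g' [u' [gu' fg' wu']]] := fw' d d0.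
have uu' : `|u - u'| <= 2 * d * c.
  have /(pl_dist gu gu') : forall x, `|g x - g' x| <= (2 * d) * l1norm x.
    move=> x; have := fg x; have := fg' x; rewrite !ler_norml.
    by move=> /andP[? ?] /andP[? ?]; apply/andP; split; lra.
  by move=> /le_vabs_norm; rewrite normrZ gtr0_norm ?mulr_gt0.
have -> : w - w' = (w - u) + (u - u') + (u' - w') by rewrite !subrKA.
apply: le_trans (ler_normD _ _) _; rewrite distrC in wu'.
have := ler_normD (w - u) (u - u').
move: uu' wu wu' de => /=; lra.
Qed.

Lemma pl_limit_exists v f : krivine_fun f -> exists w, pl_limit v f w.
Proof.
move=> kf; have ek k : 0 < k.+1%:R^-1 :> R by rewrite invr_gt0 ltr0n.
have /boolp.choice[gu guP] : forall k, exists p : ('rV[R]_n -> R) * E,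
    pl v p.1 p.2 /\ forall x, `|f x - p.1 x| <= k.+1%:R^-1 * l1norm x.
  by move=> k; have [g [u gu]] := pl_dense v kf (ek k); exists (g, u).
(* The added 1 keeps [d] positive and the Cauchy estimate strict even when [vl1 v] is 0. *)
pose d := `|vl1 v| + 1; have d0 : 0 < d by rewrite ltr_wpDl.
have [w wP] : exists w, forall k, ball (gu k).2 (2 * (d / k.+1%:R)) w.
  apply: (@harmonic_limit R E (fun k => (gu k).2)) => // k l.
  rewrite -ball_normE /=.
  have : `|(gu k).2 - (gu l).2| <= (k.+1%:R^-1 + l.+1%:R^-1) * `|vl1 v|.
    rewrite -[in leRHS](ger0_norm (x := k.+1%:R^-1 + l.+1%:R^-1)); last first.
      by rewrite addr_ge0 // ltW.
    rewrite -normrZ; apply: le_vabs_norm.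
    apply: (pl_dist (guP k).1 (guP l).1) => x.
    have := (guP k).2 x; have := (guP l).2 x; rewrite !ler_norml mulrDl.
    move: (_ * l1norm x) (_ * l1norm x) => a b.
    by move=> /andP[? ?] /andP[? ?]; apply/andP; split; lra.
  move=> /le_lt_trans; apply; rewrite -mulrDr mulrC ltr_pM2r ?addr_gt0 //.
  by rewrite /d ltrDl.
exists w => e e0.
have [K1 hK1] := harmonic_lt 1 e0; have [K2 hK2] := harmonic_lt (2 * d) e0.
pose k := maxn K1 K2; exists (gu k).1, (gu k).2; split; first exact: (guP k).1.
- move=> x; apply: le_trans ((guP k).2 x) _.
  rewrite ler_wpM2r ?l1norm_ge0 // ltW // -[X in X < _]mul1r hK1 //.
  exact: leq_maxl.
- have := wP k; rewrite -ball_normE /= distrC => /ltW /le_trans; apply.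
  by rewrite mulrA ltW // hK2 // leq_maxr.
Qed.

Lemma pl_limit_lin v a f g u w : pl_limit v f u -> pl_limit v g w ->
  pl_limit v (fun x => a * f x + g x) (a *: u + w).
Proof.
move=> fu gw e e0; pose d := e / (`|a| + 1).
have a1 : 0 < `|a| + 1 by rewrite ltr_wpDl.
have d0 : 0 < d by rewrite divr_gt0.
have de : (`|a| + 1) * d = e by rewrite mulrC divfK ?gt_eqF.
have [f1 [u1 [fu1 ff1 uu1]]] := fu d d0.
have [g1 [w1 [gw1 gg1 ww1]]] := gw d d0.
exists (fun x => a * f1 x + g1 x), (a *: u1 + w1); split.
- exact: pl_lin.
- move=> x; rewrite -de opprD addrACA -mulrBr.
  apply: le_trans (ler_normD _ _) _; rewrite normrM -mulrA mulrDl mul1r.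
  by rewrite lerD // ler_wpM2l.
- rewrite -de opprD addrACA -scalerBr.
  apply: le_trans (ler_normD _ _) _; rewrite normrZ mulrDl mul1r.
  by rewrite lerD // ler_wpM2l.
Qed.

Lemma max_lipschitz (a b c d : R) :
  `|Num.max a b - Num.max c d| <= Num.max `|a - c| `|b - d|.
Proof.
have := lexx (Num.max `|a - c| `|b - d|); rewrite {1}ge_max !ler_norml.
move: (Num.max `|a - c| _) => m /andP[/andP[? ?] /andP[? ?]].
case: (leP a b) => ?; case: (leP c d) => ?; apply/andP; split; lra.
Qed.

Lemma pl_limit_max v f g u w : pl_limit v f u -> pl_limit v g w ->
  pl_limit v (fun x => Num.max (f x) (g x)) (vjoin u w).
Proof.
move=> fu gw e e0; pose d := e / 2; have d0 : 0 < d by rewrite divr_gt0.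
have [f1 [u1 [fu1 ff1 uu1]]] := fu d d0.
have [g1 [w1 [gw1 gg1 ww1]]] := gw d d0.
exists (fun x => Num.max (f1 x) (g1 x)), (vjoin u1 w1); split.
- exact: pl_max.
- move=> x; apply: le_trans (max_lipschitz _ _ _ _) _.
  have : d * l1norm x <= e * l1norm x by rewrite ler_wpM2r ?l1norm_ge0 // /d; lra.
  by rewrite ge_max => h; rewrite !(le_trans _ h).
- apply: le_trans (norm_vjoin_lipschitz _ _ _ _) _.
  by rewrite [leRHS]splitr lerD.
Qed.

Lemma krivine_hom_exists v : exists tau, krivine_hom v tau.
Proof.
pose tau f := xget 0 [set w | pl_limit v f w].
have tauP f w : pl_limit v f w -> tau f = w.
  move=> fw; apply: (@pl_limit_unique v f) => //.
  exact: (@xgetPex _ 0 [set w | pl_limit v f w] (ex_intro _ w fw)).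
have kP f : krivine_fun f -> pl_limit v f (tau f).
  by move=> /(pl_limit_exists v)[w fw]; rewrite (tauP f w).
exists tau; split.
- by move=> j; apply/tauP/pl_limit_pl; exact: pl_coord.
- by move=> a f g /kP fP /kP gP; exact/tauP/pl_limit_lin.
- by move=> f g /kP fP /kP gP; exact/tauP/pl_limit_max.
- move=> f g kf kg; apply: tauP.
  (* Minima are obtained as f + g - max (f, g), in accordance with [vmeetE]. *)
  have := pl_limit_lin (-1) (pl_limit_max (kP f kf) (kP g kg))
    (pl_limit_lin 1 (kP f kf) (kP g kg)).
  rewrite scaleN1r scale1r addrC -vmeetE; congr pl_limit; apply/funext => x.
  by case: (leP (f x) (g x)) => ?; ring.
Qed.

Lemma krivine_hom_pl v tau f w : krivine_hom v tau -> pl v f w -> tau f = w.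
Proof.
move=> [tcoord tlin tmax _].
elim=> {f w} [|j|a f g u w fu IHf gw IHg|f g u w fu IHf gw IHg].
- have := tlin (-1) _ _ krivine_fun0 krivine_fun0.
  by rewrite mulr0 addr0 scaleN1r addNr.
- exact: tcoord.
- by rewrite tlin ?IHf ?IHg //; [exact: pl_krivine_fun fu|exact: pl_krivine_fun gw].
- by rewrite tmax ?IHf ?IHg //; [exact: pl_krivine_fun fu|exact: pl_krivine_fun gw].
Qed.

Lemma krivine_hom_le v tau f g : krivine_hom v tau ->
  krivine_fun f -> krivine_fun g -> (forall x, f x <= g x) ->
  vle (tau f) (tau g).
Proof.
move=> [_ _ tmax _] kf kg fg; apply/vle_joinE; rewrite -tmax //; congr tau.
by apply/funext => x; exact/max_idPr.
Qed.

Lemma krivine_hom_dist v tau f g h : krivine_hom v tau ->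
  krivine_fun f -> krivine_fun g -> krivine_fun h ->
  (forall x, `|f x - g x| <= h x) -> vle (vabs (tau f - tau g)) (tau h).
Proof.
move=> tau_hom kf kg kh fgh; have [_ tlin _ _] := tau_hom.
have half f1 g1 : krivine_fun f1 -> krivine_fun g1 ->
    (forall x, f1 x - g1 x <= h x) -> vle (tau f1 - tau g1) (tau h).
  move=> kf1 kg1 fgh1; rewrite addrC -scaleN1r -tlin //.
  apply: (krivine_hom_le tau_hom) => // [|x]; first exact: krivine_fun_lin.
  by rewrite mulN1r addrC.
apply: vabs_lub; rewrite ?opprB; apply: half => // x;
  by have := fgh x; rewrite ler_norml => /andP[]; lra.
Qed.

(** A homomorphism is monotone, so it is automatically continuous relative to [l1norm]; its values
    on piecewise-linear functions are forced, and by density so are all others. *)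
Lemma krivine_hom_pl_limit v tau f : krivine_hom v tau -> krivine_fun f ->
  pl_limit v f (tau f).
Proof.
move=> tau_hom kf e e0; pose c := `|vl1 v|; pose d := e / (1 + c).
have c0 : 0 < 1 + c by rewrite ltr_pwDl // normr_ge0.
have d0 : 0 < d by rewrite divr_gt0.
have de : d * (1 + c) = e by rewrite divfK ?gt_eqF.
have [g [u [gu fg]]] := pl_dense v kf d0.
exists g, u; split => // [x|].
  apply: le_trans (fg x) _; rewrite ler_wpM2r ?l1norm_ge0 //.
  by rewrite -de ler_peMr ?(ltW d0) // lerDl normr_ge0.
have kN := krivine_fun_scale d (@krivine_fun_l1norm R n).
have := krivine_hom_dist tau_hom kf (pl_krivine_fun gu) kN fg.
rewrite (krivine_hom_pl tau_hom gu).
rewrite (krivine_hom_pl tau_hom (pl_scale d (pl_l1norm v))).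
move=> /le_vabs_norm /le_trans; apply.
by rewrite normrZ (gtr0_norm d0) -de ler_wpM2l ?(ltW d0) // lerDr.
Qed.

(** Although [krivine] picks some homomorphism, any other one computes it. Identities of the
    calculus are proved below by exhibiting a convenient [tau]. *)
Lemma krivineE v tau f : krivine_hom v tau -> krivine_fun f ->
  krivine f v = tau f.
Proof.
move=> tau_hom kf; rewrite /krivine.
have [tau' tau'_hom <-] := @xgetPex _ 0
  [set w | exists2 tau, krivine_hom v tau & tau f = w]
  (ex_intro _ _ (ex_intro2 _ _ tau tau_hom erefl)).
by apply: (@pl_limit_unique v f); exact: krivine_hom_pl_limit.
Qed.

Lemma krivine_is_hom v : krivine_hom v (fun f => krivine f v).
Proof.
have [tau tau_hom] := krivine_hom_exists v; have [tcoord tlin tmax tmin] := tau_hom.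
split.
- by move=> j; rewrite (krivineE tau_hom) //; exact: krivine_fun_coord.
- by move=> a f g kf kg; rewrite !(krivineE tau_hom) ?tlin //; exact: krivine_fun_lin.
- by move=> f g kf kg; rewrite !(krivineE tau_hom) ?tmax //; exact: krivine_fun_max.
- by move=> f g kf kg; rewrite !(krivineE tau_hom) ?tmin //; exact: krivine_fun_min.
Qed.

End krivine_calculus.

(** * Weighted l^q norms *)

Section weighted_lq.
Context {R : realType}.
Implicit Types (q : \bar R) (r : R).

Lemma young_tangent r (a b : R) : 1 <= r -> 0 <= a -> 0 <= b ->
  b `^ (r - 1) * a <= (1 - r^-1) * b `^ r + r^-1 * a `^ r.
Proof.
rewrite le_eqVlt => /predU1P[<-|r1] a0 b0.
  by rewrite subrr powRr0 invr1 subrr mul0r add0r !mul1r powRr1.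
have r0 : 0 < r by exact: lt_trans r1.
have rB0 : 0 < r - 1 by rewrite subr_gt0.
have := @conjugate_powR R (b `^ (r - 1)) a (r / (r - 1)) r (powR_ge0 _ _) a0.
rewrite divr_gt0 // => /(_ isT r0); rewrite -powRrM.
have -> : (r - 1) * (r / (r - 1)) = r by rewrite mulrCA mulfV ?mulr1 // gt_eqF.
have -> : (r / (r - 1))^-1 = 1 - r^-1.
  by field; rewrite !gt_eqF.
rewrite subrK => /(_ erefl) /le_trans; apply.
by rewrite ![_ * _^-1]mulrC; lra.
Qed.

Lemma wlq_ge0 q n (lam a : 'I_n -> R) : 0 <= wlq q lam a.
Proof.
case: q => [r||] /=; first exact: powR_ge0.
- exact: bigmax_ge_id.
- exact: bigmax_ge_id.
Qed.

Lemma sum_powR_ge0 r n (lam a : 'I_n -> R) : (forall j, 0 <= lam j) ->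
  0 <= \sum_j lam j * a j `^ r.
Proof. by move=> lam0; apply: sumr_ge0 => j _; rewrite mulr_ge0 // powR_ge0. Qed.

Lemma powR_root r (s : R) : 1 <= r -> 0 <= s -> (s `^ r^-1) `^ r = s.
Proof.
move=> r1 s0; rewrite -powRrM mulVf ?powRr1 //.
by rewrite gt_eqF // (lt_le_trans ltr01).
Qed.

Lemma powR_rootK r (s : R) : 1 <= r -> 0 <= s -> (s `^ r) `^ r^-1 = s.
Proof. by move=> r1 s0; rewrite powRAC powR_root. Qed.

Lemma wlq_le q n (lam a b : 'I_n -> R) : (1 <= q)%E ->
  (forall j, 0 <= lam j) -> (forall j, 0 <= a j <= b j) ->
  wlq q lam a <= wlq q lam b.
Proof.
move=> q1 lam0 ab; case: q q1 => [r||//]; rewrite ?lee_fin /= => r1.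
  have r0 : 0 <= r by exact: le_trans r1.
  have a0 j : 0 <= a j by have /andP[] := ab j.
  have b0 j : 0 <= b j by have /andP[/le_trans + h] := ab j; apply.
  apply: ge0_ler_powR; rewrite ?invr_ge0 ?nnegrE ?sum_powR_ge0 //.
  apply: ler_sum => j _; rewrite ler_wpM2l //.
  by apply: ge0_ler_powR; rewrite ?nnegrE //; have /andP[] := ab j.
apply: bigmax_le; first exact: bigmax_ge_id.
move=> j _; apply: le_trans (le_bigmax _ _ j) => /=.
by rewrite ler_wpM2l //; have /andP[] := ab j.
Qed.

Lemma wlqZ q n (lam a : 'I_n -> R) t : (1 <= q)%E ->
  (forall j, 0 <= lam j) -> (forall j, 0 <= a j) -> 0 <= t ->
  wlq q lam (fun j => t * a j) = t * wlq q lam a.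
Proof.
move=> q1 lam0 a0 t0; case: q q1 => [r||//]; rewrite ?lee_fin /= => r1.
  under eq_bigr do rewrite powRM // mulrCA.
  by rewrite -mulr_sumr powRM ?powR_ge0 ?sum_powR_ge0 // powR_rootK.
elim/big_ind2 : _ => [|x1 x2 y1 y2 -> ->|j _]; first by rewrite mulr0.
  by rewrite maxr_pMr.
by rewrite mulrCA.
Qed.

(** Duality of l^q with a norming functional at [y]. For [q = +oo] it is a signed multiple of a
    coordinate where the maximum is reached; if the norm of [y] is 0, the zero functional does. *)
Lemma wlq_support q n (lam y : 'I_n -> R) : (1 <= q)%E ->
  (forall j, 0 <= lam j) -> exists l : 'I_n -> R,
    (forall x : 'I_n -> R, \sum_j l j * x j <= wlq q lam (fun j => `|x j|)) /\
    \sum_j l j * y j = wlq q lam (fun j => `|y j|).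
Proof.
move=> q1 lam0; have [->|Nn0] := eqVneq (wlq q lam (fun j => `|y j|)) 0.
  exists (fun=> 0); split=> [x|]; last by rewrite big1 // => j _; rewrite mul0r.
  by rewrite big1 ?wlq_ge0 // => j _; rewrite mul0r.
have N0 : 0 < wlq q lam (fun j => `|y j|) by rewrite lt_neqAle eq_sym Nn0 wlq_ge0.
case: q q1 N0 {Nn0} => [r||//]; rewrite ?lee_fin => r1; last first.
  case: n lam y lam0 => [|n] lam y lam0 N0.
    by move: N0; rewrite /wlq big_ord0 ltxx.
  have [k _ kmax] := @Order.TotalTheory.arg_maxP _ _ 'I_n.+1 ord0 xpredT
                       (fun k => lam k * `|y k|) isT.
  exists (fun j => if j == k then lam k * Num.sg (y k) else 0).
  have sumE (x : 'I_n.+1 -> R) :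
      \sum_j (if j == k then lam k * Num.sg (y k) else 0) * x j =
      lam k * (Num.sg (y k) * x k).
    rewrite (bigD1 k) //= eqxx big1 ?addr0 ?mulrA // => j /negbTE ->.
    by rewrite mul0r.
  split=> [x|]; rewrite sumE.
    apply: le_trans (le_bigmax _ _ k); rewrite ler_wpM2l //.
    apply: le_trans (ler_norm _) _; rewrite normrM.
    by rewrite ler_piMl // normr_sg; case: (y k == 0).
  rewrite -normrEsg; apply/eqP; rewrite eq_le; apply/andP; split.
    exact: (@le_bigmax _ _ _ 0 (fun j => lam j * `|y j|) k).
  apply: bigmax_le => [|j _]; last exact: kmax.
  by rewrite mulr_ge0.
set N := wlq _ _ _ => N0; have r0 : 0 < r by exact: lt_le_trans r1.
have NE : \sum_j lam j * `|y j| `^ r = N `^ r.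
  by rewrite /N /= powR_root // sum_powR_ge0.
(* The coefficients of the gradient of the norm at [y]. The bound is Hölder's inequality, obtained
   by summing [young_tangent] over the normalized coordinates. *)
clearbody N; exists (fun j => lam j * Num.sg (y j) * (`|y j| / N) `^ (r - 1)); split=> [x|].
  apply/ler_addgt0Pl => e e0.
  have Nx0 := wlq_ge0 r%:E lam (fun j => `|x j|).
  (* Normalizing [x] by slightly more than its norm avoids dividing by 0. *)
  set M := e + _; have M0 : 0 < M by exact: ltr_pwDl.
  have NM : wlq r%:E lam (fun j => `|x j|) <= M by rewrite lerDr ltW.
  clearbody M.
  have ME : \sum_j lam j * (`|x j| / M) `^ r <= 1.
    under eq_bigr do rewrite powRM // ?invr_ge0 ?(ltW M0) // mulrA.
    rewrite -mulr_suml -powR_inv1 ?(ltW M0) // powRAC powR_inv1 ?powR_ge0 //.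
    rewrite ler_pdivrMr ?powR_gt0 // mul1r.
    rewrite -[leLHS](@powR_root r) ?sum_powR_ge0 //.
    apply: ge0_ler_powR; rewrite ?nnegrE ?powR_ge0 ?(ltW M0) ?(ltW r0) //.
  have yE : \sum_j lam j * (`|y j| / N) `^ r = 1.
    under eq_bigr do rewrite powRM // ?invr_ge0 ?(ltW N0) // mulrA.
    rewrite -mulr_suml NE -powRM ?invr_ge0 ?(ltW N0) // mulfV ?gt_eqF //.
    by rewrite powR1.
  apply: (@le_trans _ _ (M * \sum_j lam j *
      ((`|y j| / N) `^ (r - 1) * (`|x j| / M)))).
    rewrite mulr_sumr; apply: ler_sum => j _.
    have -> : M * (lam j * ((`|y j| / N) `^ (r - 1) * (`|x j| / M))) =
        lam j * (`|y j| / N) `^ (r - 1) * `|x j|.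
      by field; rewrite gt_eqF.
    rewrite -!mulrA ler_wpM2l // mulrCA ler_wpM2l ?powR_ge0 //.
    apply: le_trans (ler_norm _) _; rewrite normrM.
    by rewrite ler_piMl // normr_sg; case: (y j == 0).
  rewrite -[leRHS]mulr1 ler_wpM2l ?(ltW M0) //.
  apply: (@le_trans _ _ (\sum_j lam j * ((1 - r^-1) * (`|y j| / N) `^ r +
      r^-1 * (`|x j| / M) `^ r))).
    apply: ler_sum => j _; rewrite ler_wpM2l // young_tangent //.
      by rewrite divr_ge0 // ltW.
    by rewrite divr_ge0 // ltW.
  under eq_bigr do rewrite mulrDr !(mulrCA (lam _)).
  rewrite big_split /= -!mulr_sumr yE mulr1.
  apply: (@le_trans _ _ ((1 - r^-1) + r^-1 * 1)); last by rewrite mulr1 subrK.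
  by rewrite lerD2l ler_wpM2l // invr_ge0 ltW.
transitivity (\sum_j N^-1 `^ (r - 1) * (lam j * `|y j| `^ r)).
  apply: eq_bigr => j _; rewrite powRM ?invr_ge0 ?(ltW N0) //.
  rewrite -(@mulr_powRB1 _ `|y j| r) //.
  move: (`|y j| `^ _) (N^-1 `^ _) => b c; rewrite normrEsg.
  by move: (Num.sg _) => s; ring.
rewrite -mulr_sumr NE -[N `^ r]mulr_powRB1 ?(ltW N0) // mulrCA -powRM ?invr_ge0 ?(ltW N0) //.
by rewrite mulVf ?gt_eqF // powR1 mulr1.
Qed.

(** Minkowski's inequality: the functional that norms the sum is additive and bounded by the norm on
    each summand. *)
Lemma wlq_add q n (lam a b : 'I_n -> R) : (1 <= q)%E ->
  (forall j, 0 <= lam j) -> (forall j, 0 <= a j) -> (forall j, 0 <= b j) ->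
  wlq q lam (fun j => a j + b j) <= wlq q lam a + wlq q lam b.
Proof.
move=> q1 lam0 a0 b0.
have absE (c : 'I_n -> R) : (forall j, 0 <= c j) -> (fun j => `|c j|) = c.
  by move=> c0; apply/funext => j; rewrite ger0_norm.
have [l [lle]] := wlq_support (fun j => a j + b j) q1 lam0.
rewrite absE => [<-|j]; last exact: addr_ge0.
under eq_bigr do rewrite mulrDr.
rewrite big_split /=; apply: lerD.
  by rewrite -[in leRHS](absE _ a0).
by rewrite -[in leRHS](absE _ b0).
Qed.

(** Each coefficient of the norming functional at [a] is at most the norm [e j] of a unit vector,
    hence at most the sum of all of these. *)
Lemma wlq_le_sum q n (lam : 'I_n -> R) : (1 <= q)%E ->
  (forall j, 0 <= lam j) -> exists2 c, 0 <= c &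
    forall a : 'I_n -> R, (forall j, 0 <= a j) -> wlq q lam a <= c * \sum_j a j.
Proof.
move=> q1 lam0.
pose e k : R := wlq q lam (fun j => `|(j == k)%:R|).
exists (\sum_k e k) => [|a a0]; first by apply: sumr_ge0 => k _; exact: wlq_ge0.
have [l [lle <-]] : exists l : 'I_n -> R,
    (forall x : 'I_n -> R, \sum_j l j * x j <= wlq q lam (fun j => `|x j|)) /\
    \sum_j l j * a j = wlq q lam a.
  have [l [lle lE]] := wlq_support a q1 lam0.
  exists l; split => //; rewrite lE; congr wlq.
  by apply/funext => j; rewrite ger0_norm.
rewrite mulr_sumr; apply: ler_sum => j _; rewrite ler_wpM2r //.
apply: (@le_trans _ _ (e j)).
  have := lle (fun k => (k == j)%:R).
  rewrite (bigD1 j) //= eqxx mulr1 big1 ?addr0 // => k /negbTE ->.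
  by rewrite mulr0.
by rewrite (bigD1 j) //= lerDl; apply: sumr_ge0 => k _; exact: wlq_ge0.
Qed.

(** Under a linear map the factors [c j] can be moved into the vectors; this reduces weighted
    inequalities to the unweighted concavity of [V]. *)
Lemma wlq_absorb q n (lam : 'I_n -> R) : (1 <= q)%E ->
  (forall j, 0 <= lam j) -> exists c : 'I_n -> R, (forall j, 0 <= c j) /\
    forall a : 'I_n -> R, (forall j, 0 <= a j) ->
      wlq q lam a = wlq q (fun=> 1) (fun j => c j * a j).
Proof.
move=> q1 lam0; case: q q1 => [r||//]; rewrite ?lee_fin => r1.
  exists (fun j => lam j `^ r^-1); split=> [j|a a0 /=]; first exact: powR_ge0.
  congr (_ `^ _); apply: eq_bigr => j _.
  by rewrite powRM ?powR_ge0 // powR_root // mul1r.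
exists lam; split=> // a a0 /=.
by apply: eq_bigr => j _; rewrite mul1r.
Qed.

(** Realizes a scalar factor by a change of weights alone, the only rescaling compatible with a
    nonlinear [T]. *)
Lemma wlq_rescale q n (lam : 'I_n -> R) t : (1 <= q)%E ->
  (forall j, 0 < lam j) -> 0 < t ->
  exists mu : 'I_n -> R, (forall j, 0 < mu j) /\
    forall a : 'I_n -> R, (forall j, 0 <= a j) ->
      wlq q mu a = t * wlq q lam a.
Proof.
move=> q1 lam0 t0; have lam0' j : 0 <= lam j by exact: ltW.
case: q q1 => [r||//]; rewrite ?lee_fin => r1.
  exists (fun j => t `^ r * lam j); split=> [j|a a0 /=].
    by rewrite mulr_gt0 // powR_gt0.
  under eq_bigr do rewrite -mulrA.
  by rewrite -mulr_sumr powRM ?powR_ge0 ?sum_powR_ge0 // powR_rootK // ltW.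
exists (fun j => t * lam j); split=> [j|a a0]; first by rewrite mulr_gt0.
rewrite -(wlqZ _ lam0' a0 (ltW t0)) //=.
by apply: eq_bigr => j _; rewrite mulrCA mulrA.
Qed.

Lemma wlq_single q (a : R) : (1 <= q)%E -> 0 <= a ->
  wlq q (fun=> 1) (fun _ : 'I_1 => a) = a.
Proof.
move=> q1 a0; case: q q1 => [r||//]; rewrite ?lee_fin /= => r1.
  by rewrite big_ord1 mul1r powR_rootK.
by rewrite big_ord_recl big_ord0 mul1r max_l.
Qed.

Lemma wlq_coord q n (lam : 'I_n -> R) j : (1 <= q)%E ->
  (forall j, 0 <= lam j) -> 0 < lam j -> exists2 c, 0 <= c &
    forall a : 'I_n -> R, (forall j, 0 <= a j) -> a j <= c * wlq q lam a.
Proof.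
move=> q1 lam0 lamj; case: q q1 => [r||//]; rewrite ?lee_fin => r1.
  have r0 : 0 < r by exact: lt_le_trans r1.
  exists (lam j `^ r^-1)^-1 => [|a a0 /=]; first by rewrite invr_ge0 powR_ge0.
  rewrite mulrC ler_pdivlMr ?powR_gt0 // -[leLHS](@powR_rootK r) //; last first.
    by rewrite mulr_ge0 // powR_ge0.
  rewrite powRM ?powR_ge0 // powR_root ?(ltW lamj) //.
  apply: ge0_ler_powR; rewrite ?invr_ge0 ?nnegrE ?sum_powR_ge0 ?(ltW r0) //.
    by rewrite mulr_ge0 // powR_ge0.
  rewrite (bigD1 j) //= mulrC lerDl; apply: sumr_ge0 => i _.
  by rewrite mulr_ge0 // powR_ge0.
exists (lam j)^-1 => [|a a0 /=]; first by rewrite invr_ge0 ltW.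
rewrite mulrC ler_pdivlMr // mulrC.
exact: (@le_bigmax _ _ _ 0 (fun j => lam j * a j) j).
Qed.

Lemma wlq_flatten q m (N : 'I_m -> nat) (lam a : forall k, 'I_(N k) -> R) :
  (1 <= q)%E -> (forall k j, 0 <= lam k j) -> (forall k j, 0 <= a k j) ->
  let p (i : 'I_#|{: {k : 'I_m & 'I_(N k)}}|) := enum_val i in
  wlq q (fun i => lam _ (tagged (p i))) (fun i => a _ (tagged (p i))) =
  wlq q (fun=> 1) (fun k => wlq q (lam k) (a k)).
Proof.
move=> q1 lam0 a0 p; case: q q1 => [r||//]; rewrite ?lee_fin /= => r1.
  congr (_ `^ _).
  rewrite -(big_enum_val (fun z : {k : 'I_m & 'I_(N k)} =>
    lam _ (tagged z) * a _ (tagged z) `^ r)) /=.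
  under [RHS]eq_bigr do rewrite mul1r powR_root ?sum_powR_ge0 //.
  by rewrite sig_big_dep /=.
apply/eqP; rewrite eq_le; apply/andP; split.
  apply: bigmax_le => [|i _]; first exact: bigmax_ge_id.
  apply: le_trans (le_bigmax _ _ (tag (p i))) => /=; rewrite mul1r.
  exact: (@le_bigmax _ _ _ 0 (fun j => lam _ j * a _ j) (tagged (p i))).
apply: bigmax_le => [|k _]; first exact: bigmax_ge_id.
rewrite mul1r; apply: bigmax_le => [|j _]; first exact: bigmax_ge_id.
pose z : {k : 'I_m & 'I_(N k)} := Tagged (fun k => 'I_(N k)) j.
have := @le_bigmax _ _ _ (0 : R) (fun i =>
  lam _ (tagged (p i)) * a _ (tagged (p i))) (enum_rank z).
by rewrite /p enum_rankK.
Qed.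

End weighted_lq.

(** * Composition and quotients of Krivine functions *)

Section composition.
Context {R : realType}.

Lemma continuous_row (T : topologicalType) m (g : 'I_m -> T -> R) :
  (forall i, continuous (g i)) -> continuous (fun x => \row_i g i x).
Proof.
move=> cg x; apply/cvg_ballP => e e0.
have : \forall y \near x, forall i, ball (g i x) e (g i y).
  by apply: filter_forall => i; have /cvg_ballP := cg i x; apply.
apply: filterS => y h; split => // i j; by rewrite !mxE.
Qed.

Lemma krivine_fun_comp n m (f : 'rV[R]_m -> R) (g : 'I_m -> 'rV[R]_n -> R) :
  krivine_fun f -> (forall i, krivine_fun (g i)) ->
  krivine_fun (fun x => f (\row_i g i x)).
Proof.
move=> [cf hf] kg; split=> [x|t x t0].
  apply: (@continuous_comp _ _ _ (fun x => \row_i g i x) f); last exact: cf.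
  by apply: continuous_row => i; have [] := kg i.
rewrite -hf //; congr f; apply/rowP => i; rewrite !mxE.
by have [_ ->] := kg i.
Qed.

Lemma continuous_dominated (T : topologicalType) (f : T -> R) (h : T -> T -> R) :
  (forall x, continuous (h x)) -> (forall x, h x x = 0) ->
  (forall x y, `|f x - f y| <= h x y) -> continuous f.
Proof.
move=> ch h0 fh x; apply/cvgrPdist_lt => e e0.
have /cvgrPdist_lt /(_ e e0) := ch x x; apply: filterS => y.
rewrite h0 sub0r normrN; apply: le_lt_trans.
exact: le_trans (fh x y) (ler_norm _).
Qed.

(** The ratio [b / D] need not be continuous at a zero of [D], but it is bounded by 1 and [a] tends
    to 0 there, so the product does too. *)
Lemma continuous_quot (T : topologicalType) (a b D : T -> R) c :
  continuous a -> continuous b -> continuous D ->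
  (forall x, `|a x| <= c * D x) -> (forall x, `|b x| <= D x) ->
  continuous (fun x => a x * (b x / D x)).
Proof.
move=> ca cb cD aD bD x.
have bD1 y : `|b y / D y| <= 1.
  have D0 : 0 <= D y by apply: le_trans (bD y).
  rewrite normrM normfV (ger0_norm D0).
  have [->|Dn0] := eqVneq (D y) 0; first by rewrite invr0 mulr0.
  by rewrite ler_pdivrMr ?mul1r // lt_neqAle eq_sym Dn0.
have [Dx0|Dn0] := eqVneq (D x) 0; last first.
  apply: cvgM; first exact: ca.
  by apply: cvgM; [exact: cb|apply: cvgV => //; exact: cD].
have ax0 : a x = 0.
  by apply/normr0_eq0/eqP; rewrite eq_le normr_ge0 andbT (le_trans (aD x)) // Dx0 mulr0.
apply/cvgrPdist_lt => e e0.
have /cvgrPdist_lt /(_ e e0) := ca x; apply: filterS => y.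
rewrite /= ax0 mul0r !sub0r !normrN; apply: le_lt_trans.
by rewrite normrM ler_piMr.
Qed.

Lemma krivine_fun_quot n (a b D : 'rV[R]_n -> R) c :
  krivine_fun a -> krivine_fun b -> krivine_fun D ->
  (forall x, `|a x| <= c * D x) -> (forall x, `|b x| <= D x) ->
  krivine_fun (fun x => a x * (b x / D x)).
Proof.
move=> [ca ha] [cb hb] [cD hD] aD bD; split=> [|t x t0].
  exact: continuous_quot ca cb cD aD bD.
rewrite ha // hb // hD //; have [->|tn0] := eqVneq t 0; first by rewrite !mul0r.
by rewrite -mulf_div divff // mul1r mulrA.
Qed.

End composition.

Section krivine_values.
Context {R : realType} {n : nat} {E : banachLatticeType R} (u : 'I_n -> E).
Implicit Types (f g : 'rV[R]_n -> R) (v w : E).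

(* Closed under every operation below, so that [kval_le] transfers a pointwise
   inequality on R^n to one in [E]. *)
Definition kval f w := krivine_fun f /\ krivine f u = w.

Lemma kval_krivine f : krivine_fun f -> kval f (krivine f u).
Proof. by []. Qed.

Lemma kval_coord j : kval (fun x => x ord0 j) (u j).
Proof. by split; [exact: krivine_fun_coord|case: (krivine_is_hom u)]. Qed.

Lemma kval_lin a f g v w : kval f v -> kval g w ->
  kval (fun x => a * f x + g x) (a *: v + w).
Proof.
move=> [kf <-] [kg <-]; split; first exact: krivine_fun_lin.
by case: (krivine_is_hom u) => _ ->.
Qed.

Lemma kval_max f g v w : kval f v -> kval g w ->
  kval (fun x => Num.max (f x) (g x)) (vjoin v w).
Proof.
move=> [kf <-] [kg <-]; split; first exact: krivine_fun_max.
by case: (krivine_is_hom u) => _ _ ->.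
Qed.

Lemma kval0 : kval (fun=> 0) 0.
Proof.
split; first exact: krivine_fun0.
exact: krivine_hom_pl (krivine_is_hom u) (pl_zero u).
Qed.

Lemma kval_congr f g v w : kval f v -> f =1 g -> v = w -> kval g w.
Proof. by move=> fv /funext <- <-. Qed.

Lemma kval_add f g v w : kval f v -> kval g w ->
  kval (fun x => f x + g x) (v + w).
Proof.
move=> fv gw; apply: (kval_congr (kval_lin 1 fv gw)) => [x|].
  by rewrite mul1r.
by rewrite scale1r.
Qed.

Lemma kval_scale a f v : kval f v -> kval (fun x => a * f x) (a *: v).
Proof.
by move=> fv; apply: (kval_congr (kval_lin a fv kval0)) => [x|]; rewrite addr0.
Qed.

Lemma kval_opp f v : kval f v -> kval (fun x => - f x) (- v).
Proof.
move=> fv; apply: (kval_congr (kval_scale (-1) fv)) => [x|].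
  by rewrite mulN1r.
by rewrite scaleN1r.
Qed.

Lemma kval_sub f g v w : kval f v -> kval g w ->
  kval (fun x => f x - g x) (v - w).
Proof. by move=> fv gw; exact/kval_add/kval_opp. Qed.

Lemma kval_abs f v : kval f v -> kval (fun x => `|f x|) (vabs v).
Proof.
move=> fv; apply: (kval_congr (kval_max fv (kval_opp fv))) => // x.
by case: (lerP 0 (f x)) => h; [rewrite ger0_norm ?max_l|rewrite ltr0_norm ?max_r]; lra.
Qed.

Lemma kval_sum (I : Type) (r : seq I) (F : I -> 'rV[R]_n -> R) (U : I -> E) :
  (forall i, kval (F i) (U i)) ->
  kval (fun x => \sum_(i <- r) F i x) (\sum_(i <- r) U i).
Proof.
move=> FU; elim: r => [|i r IH].
  by apply: (kval_congr kval0) => [x|]; rewrite big_nil.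
by apply: (kval_congr (kval_add (FU i) IH)) => [x|]; rewrite big_cons.
Qed.

Lemma kval_bigmax (I : Type) (r : seq I) (F : I -> 'rV[R]_n -> R) (U : I -> E) :
  (forall i, kval (F i) (U i)) ->
  kval (fun x => \big[Num.max/0]_(i <- r) F i x) (\big[vjoin/0]_(i <- r) U i).
Proof.
move=> FU; elim: r => [|i r IH].
  by apply: (kval_congr kval0) => [x|]; rewrite big_nil.
by apply: (kval_congr (kval_max (FU i) IH)) => [x|]; rewrite big_cons.
Qed.

Lemma kval_le f g v w : kval f v -> kval g w -> (forall x, f x <= g x) ->
  vle v w.
Proof.
by move=> [kf <-] [kg <-] fg; exact: (krivine_hom_le (krivine_is_hom u)).
Qed.

Lemma kval_eq f v w : kval f v -> kval f w -> v = w.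
Proof. by move=> [_ <-] [_ <-]. Qed.

(** Precomposition with [g] followed by evaluation at [u] is a homomorphism sending the coordinates
    to [w], and uniqueness identifies it with the calculus at [w]. *)
Lemma kval_comp m (f : 'rV[R]_m -> R) (g : 'I_m -> 'rV[R]_n -> R) (w : 'I_m -> E) :
  krivine_fun f -> (forall i, kval (g i) (w i)) ->
  kval (fun x => f (\row_i g i x)) (krivine f w).
Proof.
move=> kf gw; have kg i : krivine_fun (g i) by have [] := gw i.
split; first exact: krivine_fun_comp.
apply/esym; pose tau (f' : 'rV[R]_m -> R) := krivine (fun x => f' (\row_i g i x)) u.
apply: (@krivineE _ _ _ w tau) => //.
have [_ tlin tmax tmin] := krivine_is_hom u; split.
- move=> j; rewrite /tau; have [_ <-] := gw j; congr krivine.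
  by apply/funext => x; rewrite mxE.
- by move=> a f1 f2 k1 k2; rewrite /tau -tlin //; exact: krivine_fun_comp.
- by move=> f1 f2 k1 k2; rewrite /tau -tmax //; exact: krivine_fun_comp.
- by move=> f1 f2 k1 k2; rewrite /tau -tmin //; exact: krivine_fun_comp.
Qed.

End krivine_values.

Lemma krivine_lattice_hom (R : realType) n (E F : banachLatticeType R)
    (phi : {linear E -> F}) (f : 'rV[R]_n -> R) (v : 'I_n -> E) :
  lattice_hom phi -> krivine_fun f ->
  phi (krivine f v) = krivine f (fun i => phi (v i)).
Proof.
move=> [pjoin pmeet] kf; apply/esym.
apply: (@krivineE _ _ _ _ (fun g => phi (krivine g v))) => //.
have [tcoord tlin tmax tmin] := krivine_is_hom v; split.
- by move=> j; rewrite tcoord.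
- by move=> a f1 f2 k1 k2; rewrite tlin // linearP.
- by move=> f1 f2 k1 k2; rewrite tmax // pjoin.
- by move=> f1 f2 k1 k2; rewrite tmin // pmeet.
Qed.

(** The positive part of [a - b] lies below every [e *: c], so its norm is 0. *)
Lemma vle_archimedean (R : realType) (E : banachLatticeType R) (a b c : E) :
  vle 0 c -> (forall e : R, 0 < e -> vle a (b + e *: c)) -> vle a b.
Proof.
move=> c0 abc; pose p := vjoin (a - b) 0.
have p0 : vle 0 p by exact: vjoin_ubr.
have pc e : 0 < e -> `|p| <= e * `|c|.
  move=> e0; rewrite -[e in leRHS]gtr0_norm // -normrZ; apply: le_vabs_norm.
  rewrite vabs_id //; apply: vjoin_lub; last by apply: vscale_ge0; rewrite ?ltW.
  by apply/vle_subl; rewrite addrC; exact: abc.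
have p_eq0 : p = 0.
  apply/normr0_eq0/eqP; rewrite eq_le normr_ge0 andbT.
  apply/ler_addgt0Pl => e e0; rewrite addr0.
  have c1 : 0 < `|c| + 1 by rewrite ltr_wpDl.
  apply: le_trans (pc (e / (`|c| + 1)) _) _; first by rewrite divr_gt0.
  by rewrite mulrAC ler_pdivrMr // ler_wpM2l ?(ltW e0) // lerDl.
have : vle (a - b) 0 by rewrite -p_eq0; exact: vjoin_ubl.
by move/vle_subl; rewrite add0r.
Qed.

(** * The l^q expressions of vectors *)

Section vector_lq.
Context {R : realType} (q : \bar R) (q1 : (1 <= q)%E).
Implicit Types (E F : banachLatticeType R).

Definition wnorm n (lam : 'I_n -> R) (x : 'rV[R]_n) : R :=
  wlq q lam (fun j => `|x ord0 j|).

Lemma wnorm_add n (lam : 'I_n -> R) (x y : 'rV[R]_n) : (forall j, 0 <= lam j) ->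
  wnorm lam (x + y) <= wnorm lam x + wnorm lam y.
Proof.
move=> lam0; apply: le_trans (wlq_add q1 lam0 _ _) => //.
by apply: wlq_le => // j; rewrite normr_ge0 mxE ler_normD.
Qed.

Lemma wnormN n (lam : 'I_n -> R) (x : 'rV[R]_n) : wnorm lam (- x) = wnorm lam x.
Proof. by congr wlq; apply/funext => j; rewrite mxE normrN. Qed.

Lemma wnorm_dist n (lam : 'I_n -> R) (x y : 'rV[R]_n) : (forall j, 0 <= lam j) ->
  `|wnorm lam x - wnorm lam y| <= wnorm lam (x - y).
Proof.
move=> lam0; rewrite ler_norml; apply/andP; split.
  have := wnorm_add (y - x) x lam0; rewrite subrK -[y - x]opprB wnormN; lra.
by have := wnorm_add (x - y) y lam0; rewrite subrK; lra.
Qed.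

Lemma krivine_fun_wnorm n (lam : 'I_n -> R) : (forall j, 0 <= lam j) ->
  krivine_fun (wnorm lam).
Proof.
move=> lam0; split=> [|t x t0]; last first.
  rewrite /wnorm -wlqZ //; congr wlq; apply/funext => j.
  by rewrite mxE normrM ger0_norm.
have [c c0 cP] := wlq_le_sum q1 lam0.
apply: (@continuous_dominated _ _ _ (fun x y : 'rV[R]_n => c * l1norm (x - y) + 0)).
- move=> x; apply: continuous_lin; last exact: cst_continuous.
  apply: continuous_sum_fun => j _; apply: continuous_abs.
  under eq_fun do rewrite !mxE.
  by apply: continuous_sub; [exact: cst_continuous|exact: coord_continuous].
- by move=> x; rewrite subrr -(scale0r 0) l1normZ normr0 mul0r mulr0 addr0.
- by move=> x y; rewrite addr0; apply: le_trans (wnorm_dist _ _ lam0) _; exact: cP.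
Qed.

(** For [q = +oo] the expression was an iterated join; this brings it under the calculus, so that
    both kinds of exponent are treated alike from here on. *)
Lemma vwlqE n (lam : 'I_n -> R) E (v : 'I_n -> E) : (forall j, 0 <= lam j) ->
  vwlq q lam v = krivine (wnorm lam) v.
Proof.
move=> lam0; have := krivine_fun_wnorm lam0; rewrite /vwlq /wnorm.
case: q q1 => [r _ //|_|//] /= kN.
apply: (kval_eq _ (kval_krivine v kN)).
by apply: kval_bigmax => j; apply/kval_scale/kval_abs; exact: kval_coord.
Qed.

Lemma kval_vwlq n m (lam : 'I_m -> R) E (u : 'I_n -> E) (w : 'I_m -> E)
    (g : 'I_m -> 'rV[R]_n -> R) :
  (forall j, 0 <= lam j) -> (forall i, kval u (g i) (w i)) ->
  kval u (fun x => wlq q lam (fun j => `|g j x|)) (vwlq q lam w).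
Proof.
move=> lam0 gw; rewrite vwlqE //.
apply: (kval_congr (kval_comp (krivine_fun_wnorm lam0) gw)) => // x.
by congr wlq; apply/funext => j; rewrite mxE.
Qed.

Lemma vwlq_lattice_hom n (lam : 'I_n -> R) E F (phi : {linear E -> F})
    (v : 'I_n -> E) :
  (forall j, 0 <= lam j) -> lattice_hom phi ->
  phi (vwlq q lam v) = vwlq q lam (fun j => phi (v j)).
Proof.
move=> lam0 hphi; rewrite !vwlqE //; apply: krivine_lattice_hom => //.
exact: krivine_fun_wnorm.
Qed.

Lemma vwlq_ge0 n (lam : 'I_n -> R) E (v : 'I_n -> E) : (forall j, 0 <= lam j) ->
  vle 0 (vwlq q lam v).
Proof.
move=> lam0; apply: kval_le (kval0 v) (kval_vwlq lam0 (kval_coord v)) _ => x.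
exact: wlq_ge0.
Qed.

Section two_families.
Context {E : banachLatticeType R} {n : nat} (v w : 'I_n -> E).

(** Joining the two families lets their expressions be read as functions on the same space R^(n +
    n). *)
Let u (i : 'I_(n + n)) := match fintype.split i with inl j => v j | inr j => w j end.

Let kl j : kval u (fun x => x ord0 (lshift n j)) (v j).
Proof. by have := kval_coord u (lshift n j); rewrite /u (unsplitK (inl j)). Qed.

Let kr j : kval u (fun x => x ord0 (rshift n j)) (w j).
Proof. by have := kval_coord u (rshift n j); rewrite /u (unsplitK (inr j)). Qed.

(** The hypothesis is a relation in [E] and not between coordinate functions. The comparison passes
    through the joins of the moduli: these dominate the first family pointwise and equal the second
    one in [E]. *)
Lemma vwlq_le (lam : 'I_n -> R) : (forall j, 0 <= lam j) ->
  (forall j, vle (vabs (v j)) (vabs (w j))) ->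
  vle (vwlq q lam v) (vwlq q lam w).
Proof.
move=> lam0 vw; apply: (@vle_trans _ _ (vwlq q lam (fun j =>
    vjoin (vabs (v j)) (vabs (w j))))).
  apply: (kval_le (kval_vwlq lam0 kl) (kval_vwlq lam0 _)).
    by move=> i; exact: kval_max (kval_abs (kl i)) (kval_abs (kr i)).
  move=> x; apply: wlq_le => // j; rewrite normr_ge0 /=.
  by apply: le_trans (ler_norm _); rewrite le_max lexx.
have -> : (fun j => vjoin (vabs (v j)) (vabs (w j))) = (fun j => vabs (w j)).
  by apply/funext => j; apply/vle_joinE.
apply: (kval_le (kval_vwlq lam0 (fun j => kval_abs (kr j))) (kval_vwlq lam0 kr)) => x.
by apply: wlq_le => // j; rewrite normr_ge0 normr_id lexx.
Qed.

Lemma vwlq_dist (lam : 'I_n -> R) : (forall j, 0 <= lam j) ->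
  vle (vabs (vwlq q lam v - vwlq q lam w)) (vwlq q lam (fun j => v j - w j)).
Proof.
move=> lam0; apply: kval_le (kval_abs (kval_sub (kval_vwlq lam0 kl)
  (kval_vwlq lam0 kr))) (kval_vwlq lam0 (fun j => kval_sub (kl j) (kr j))) _ => x.
have := wnorm_dist (\row_j x ord0 (lshift n j)) (\row_j x ord0 (rshift n j)) lam0.
have -> : \row_j x ord0 (lshift n j) - \row_j x ord0 (rshift n j) =
    \row_j (x ord0 (lshift n j) - x ord0 (rshift n j)).
  by apply/rowP => j; rewrite !mxE.
have rowE (f : 'I_n -> R) :
    (fun j => `|(\row_i f i) ord0 j|) = (fun j => `|f j|).
  by apply/funext => j; rewrite mxE.
by rewrite /wnorm !rowE.
Qed.

End two_families.

Lemma norm_vwlq_dist n (lam : 'I_n -> R) : (forall j, 0 <= lam j) ->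
  exists2 c, 0 <= c & forall E (v w : 'I_n -> E),
    `|vwlq q lam v - vwlq q lam w| <= c * \sum_j `|v j - w j|.
Proof.
move=> lam0; have [c c0 cP] := wlq_le_sum q1 lam0; exists c => // E v w.
have h : vle (vabs (vwlq q lam v - vwlq q lam w)) (c *: \sum_j vabs (v j - w j)).
  apply: vle_trans (vwlq_dist v w lam0) _.
  apply: (kval_le (kval_vwlq lam0 (kval_coord (fun j => v j - w j)))
    (kval_scale c (kval_sum _ (fun j => kval_abs (kval_coord _ j))))) => x.
  by apply: cP.
apply: le_trans (le_vabs_norm h) _; rewrite normrZ (ger0_norm c0) ler_wpM2l //.
apply: le_trans (ler_norm_sum _ _ _) _.
by apply: ler_sum => j _; rewrite norm_vabs.
Qed.

Lemma vwlq_rescale n (lam : 'I_n -> R) t : (forall j, 0 <= lam j) ->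
  forall mu : 'I_n -> R, (forall j, 0 <= mu j) ->
  (forall a : 'I_n -> R, (forall j, 0 <= a j) -> wlq q mu a = t * wlq q lam a) ->
  forall E (v : 'I_n -> E), vwlq q mu v = t *: vwlq q lam v.
Proof.
move=> lam0 mu mu0 muE E v; apply: (kval_eq (kval_vwlq mu0 (kval_coord v))).
apply: (kval_congr (kval_scale t (kval_vwlq lam0 (kval_coord v)))) => // x.
by rewrite muE.
Qed.

Lemma vwlq_absorb n (lam c : 'I_n -> R) : (forall j, 0 <= lam j) ->
  (forall j, 0 <= c j) ->
  (forall a : 'I_n -> R, (forall j, 0 <= a j) ->
    wlq q lam a = wlq q (fun=> 1) (fun j => c j * a j)) ->
  forall E (v : 'I_n -> E),
    vwlq q lam v = vwlq q (fun=> 1) (fun j => c j *: v j).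
Proof.
move=> lam0 c0 cE E v; apply: (kval_eq (kval_vwlq lam0 (kval_coord v))).
apply: (kval_congr (@kval_vwlq _ _ (fun=> 1) _ _ _ _ (fun=> ler01)
  (fun j => kval_scale (c j) (kval_coord v j)))) => // x.
rewrite cE //; congr wlq; apply/funext => j.
by rewrite normrM ger0_norm.
Qed.

Lemma vwlq_single E (v : E) : vwlq q (fun=> 1) (fun _ : 'I_1 => v) = vabs v.
Proof.
pose u := fun _ : 'I_1 => v.
apply: (@kval_eq _ _ _ u (fun x => `|x ord0 ord0|)); last first.
  by apply: kval_abs; exact: kval_coord.
apply: (kval_congr (@kval_vwlq _ _ (fun=> 1) _ _ _ _
  (fun=> ler01) (kval_coord u))) => // x.
rewrite -[RHS](wlq_single q1) //; congr wlq; apply/funext => j.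
by rewrite (ord1 j).
Qed.

Lemma vwlq_flatten m (N : 'I_m -> nat) (lam : forall k, 'I_(N k) -> R) E
    (v : forall k, 'I_(N k) -> E) : (forall k j, 0 <= lam k j) ->
  let p (i : 'I_#|{: {k : 'I_m & 'I_(N k)}}|) := enum_val i in
  vwlq q (fun i => lam _ (tagged (p i))) (fun i => v _ (tagged (p i))) =
  vwlq q (fun=> 1) (fun k => vwlq q (lam k) (v k)).
Proof.
move=> lam0 p; pose u i := v _ (tagged (p i)).
have kv k j : kval u (fun x => x ord0 (enum_rank (Tagged (fun k => 'I_(N k)) j))) (v k j).
  by have := kval_coord u (enum_rank (Tagged (fun k => 'I_(N k)) j));
    rewrite /u /p enum_rankK.
have kvk k := kval_vwlq (lam0 k) (kv k).
apply/esym; apply: (kval_eq (kval_vwlq (fun=> ler01) kvk)).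
apply: (kval_congr (@kval_vwlq _ _ (fun i => lam _ (tagged (p i))) _ _ _ _
  (fun i => lam0 _ _) (kval_coord u))) => // x.
pose a k (j : 'I_(N k)) : R := `|x ord0 (enum_rank (Tagged (fun k => 'I_(N k)) j))|.
have a0 k (j : 'I_(N k)) : 0 <= a k j by exact: normr_ge0.
transitivity (wlq q (fun=> 1) (fun k => wlq q (lam k) (a k))).
  rewrite -(wlq_flatten q1 lam0 a0); congr wlq; apply/funext => i; rewrite /a /p.
  congr `|x ord0 _|; rewrite -[LHS]enum_valK; congr enum_rank.
  by case: (enum_val i).
by congr wlq; apply/funext => k; rewrite ger0_norm ?wlq_ge0.
Qed.

End vector_lq.

(** * Positive operators *)

Section decomposition.
Context {R : realType} (q : \bar R) (q1 : (1 <= q)%E) (E : banachLatticeType R).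

(** The two quotients miss [z] by the fraction (D - (a + b)) / D of it. The bound is a multiple of
    [D - (a + b)], a function that will have value 0 in [E]. *)
Lemma quot_remainder (c z a b D : R) : 0 <= c -> 0 <= a -> 0 <= b ->
  `|z| <= c * D -> a + b <= D ->
  `|z - (z * (a / D) + z * (b / D))| <= c * (D - (a + b)).
Proof.
move=> c0 a0 b0 zD abD; have D0 : 0 <= D by apply: le_trans abD; exact: addr_ge0.
have sD : 0 <= D - (a + b) by rewrite subr_ge0.
have [Dt0|Dn0] := eqVneq D 0.
  have -> : z = 0.
    by apply/normr0_eq0/eqP; rewrite eq_le normr_ge0 andbT (le_trans zD) // Dt0 mulr0.
  by rewrite !mul0r addr0 subrr normr0 mulr_ge0.
have Dt : 0 < D by rewrite lt_neqAle eq_sym Dn0 D0.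
have -> : z - (z * (a / D) + z * (b / D)) = z * ((D - (a + b)) / D) by field.
rewrite !normrM normfV (ger0_norm sD) (ger0_norm D0) mulrA ler_pdivrMr //.
by rewrite mulrAC ler_wpM2r.
Qed.

(* With [D = max (|x| + |y|, wlq z)] the pieces are [z |x| / D] and
   [z |y| / D]; the hypothesis says that [D = |x| + |y|] in [E]. *)
Lemma vwlq_decomposition n (lam : 'I_n -> R) (z : 'I_n -> E) (x y : E) :
  (forall j, 0 < lam j) -> vle (vwlq q lam z) (vabs x + vabs y) ->
  exists z1 z2 : 'I_n -> E, [/\ forall j, z j = z1 j + z2 j,
    vle (vwlq q lam z1) (vabs x) & vle (vwlq q lam z2) (vabs y)].
Proof.
move=> lamP zxy; have lam0 j : 0 <= lam j by exact: ltW.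
pose u (i : 'I_(n + (1 + 1))) := match fintype.split i with
  | inl j => z j
  | inr k => match fintype.split k with inl _ => x | inr _ => y end
  end.
pose zc j (t : 'rV[R]_(n + (1 + 1))) := t ord0 (lshift (1 + 1) j).
pose xc (t : 'rV[R]_(n + (1 + 1))) := t ord0 (rshift n (lshift 1 ord0)).
pose yc (t : 'rV[R]_(n + (1 + 1))) := t ord0 (rshift n (rshift 1 ord0)).
have kz j : kval u (zc j) (z j).
  by have := kval_coord u (lshift (1 + 1) j); rewrite /u (unsplitK (inl j)).
have kx : kval u xc x.
  have := kval_coord u (rshift n (lshift 1 ord0)).
  by rewrite /u (unsplitK (inr (lshift 1 ord0))) (unsplitK (inl ord0)).
have ky : kval u yc y.
  have := kval_coord u (rshift n (rshift 1 ord0)).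
  by rewrite /u (unsplitK (inr (rshift 1 ord0))) (unsplitK (inr ord0)).
pose N t := wlq q lam (fun j => `|zc j t|).
pose s t := `|xc t| + `|yc t|.
pose D t := Num.max (s t) (N t).
have ks : kval u s (vabs x + vabs y) by apply: kval_add; exact: kval_abs.
have kN : kval u N (vwlq q lam z) by exact: kval_vwlq.
have kD : kval u D (vabs x + vabs y).
  apply: (kval_congr (kval_max ks kN)) => //.
  by rewrite vjoinC; apply/vle_joinE.
have D0 t : 0 <= D t by rewrite /D le_max addr_ge0.
have xD t : `|(`|xc t|)| <= D t by rewrite normr_id /D le_max lerDl normr_ge0.
have yD t : `|(`|yc t|)| <= D t by rewrite normr_id /D le_max lerDr normr_ge0.
have ND t : N t <= D t by rewrite /D le_max lexx orbT.
have zD j : exists2 c, 0 <= c & forall t, `|zc j t| <= c * D t.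
  have [c c0 cP] := wlq_coord q1 lam0 (lamP j); exists c => // t.
  apply: le_trans (cP (fun j => `|zc j t|) _) _ => //.
  by rewrite ler_wpM2l // ND.
(* By [zD], the coordinate vanishes wherever [D] does, so the conventional value of the division
   there is harmless. *)
pose piece (b : 'rV[R]_(n + (1 + 1)) -> R) j t := zc j t * (b t / D t).
have kpiece b w j : kval u b w -> (forall t, `|b t| <= D t) ->
    krivine_fun (piece b j).
  move=> [kb _] bD; have [c c0 cP] := zD j.
  apply: (krivine_fun_quot _ kb) => //; [by case: (kz j)|by case: kD].
have pieceP b w : kval u (fun t => `|b t|) w -> (forall t, `|(`|b t|)| <= D t) ->
    vle (vwlq q lam (fun j => krivine (piece (fun t => `|b t|) j) u)) w.
  move=> kb bD.
  apply: (kval_le (kval_vwlq q1 lam0 (fun j => kval_krivine u (kpiece _ _ j kb bD))) kb).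
  move=> t; have -> : (fun j => `|piece (fun t => `|b t|) j t|) =
      (fun j => `|b t| / D t * `|zc j t|).
    by apply/funext => j; rewrite /piece normrM normrM normr_id normfV
      (ger0_norm (D0 t)) mulrC.
  rewrite wlqZ ?divr_ge0 //; have [->|Dn0] := eqVneq (D t) 0.
    by rewrite invr0 mulr0 mul0r.
  have Dt : 0 < D t by rewrite lt_neqAle eq_sym Dn0 D0.
  by rewrite mulrAC ler_pdivrMr // ler_wpM2l // ND.
exists (fun j => krivine (piece (fun t => `|xc t|) j) u),
       (fun j => krivine (piece (fun t => `|yc t|) j) u); split; last first.
- by apply: pieceP => //; exact: kval_abs.
- by apply: pieceP => //; exact: kval_abs.
move=> j; apply/eqP; rewrite -subr_eq0 -normr_eq0 eq_le normr_ge0 andbT.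
have [c c0 cP] := zD j.
have kp1 := kval_krivine u (kpiece _ _ j (kval_abs kx) xD).
have kp2 := kval_krivine u (kpiece _ _ j (kval_abs ky) yD).
(* [D] and [s] differ as functions but have the same value in [E], which turns the pointwise bound
   on the remainder into an exact decomposition. *)
have := kval_le (kval_abs (kval_sub (kz j) (kval_add kp1 kp2)))
                (kval_scale c (kval_sub kD ks)).
rewrite subrr scaler0 => /(_ _)/le_vabs_norm; rewrite normr0; apply => t.
by apply: quot_remainder => //; rewrite /D le_max lexx.
Qed.

End decomposition.

Section positive_operators.
Context {R : realType} {E F : banachLatticeType R} (phi : {linear E -> F}).
Context (phi_pos : positive_op phi).

Lemma positive_op_le x y : vle x y -> vle (phi x) (phi y).
Proof.
move=> xy; rewrite -vsubr_ge0 -linearB; apply: phi_pos.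
by rewrite vsubr_ge0.
Qed.

Lemma positive_op_vabs x : vle (vabs (phi x)) (phi (vabs x)).
Proof.
apply: vabs_lub; first by apply: positive_op_le; exact: vabs_ub.
by rewrite -linearN; apply: positive_op_le; exact: vabs_ubN.
Qed.

(* [wlq] is a supremum of linear functionals, finitely many of which suffice up
   to [e * l1norm] by compactness. *)
Lemma vwlq_positive_op (q : \bar R) n (lam : 'I_n -> R) (v : 'I_n -> E) :
  (1 <= q)%E -> (forall j, 0 <= lam j) ->
  vle (vwlq q lam (fun j => phi (v j))) (phi (vwlq q lam v)).
Proof.
move=> q1 lam0; pose w j := phi (v j).
have /boolp.choice[L LP] : forall y : 'rV[R]_n, exists l : 'I_n -> R,
    (forall x : 'I_n -> R, \sum_j l j * x j <= wlq q lam (fun j => `|x j|)) /\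
    \sum_j l j * y ord0 j = wlq q lam (fun j => `|y ord0 j|).
  by move=> y; exact: wlq_support.
pose lin y (x : 'rV[R]_n) := \sum_j L y j * x ord0 j.
have kw := kval_coord w.
have kl1 : kval w l1norm (vl1 w) by apply: kval_sum => j; exact: kval_abs.
have klin y (w' : 'I_n -> _) : kval w' (lin y) (\sum_j L y j *: w' j).
  by apply: kval_sum => j; apply: kval_scale; exact: kval_coord.
apply: (@vle_archimedean _ _ _ _ (vl1 w)).
  by apply: vsum_ge0 => j _; exact: vabs_ge0.
move=> e e0.
have [ys _ ysP] : exists2 ys : seq 'rV[R]_n, (forall y, y \in ys -> l1sphere y) &
    forall x, l1sphere x -> exists2 y, y \in ys & wnorm q lam x - lin y x < e.
  apply: (@compact_selection _ _ _ (fun=> e) (fun y x => wnorm q lam x - lin y x)).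
  - exact: l1sphere_compact.
  - exact: cst_continuous.
  - move=> y; apply: continuous_sub; first by case: (krivine_fun_wnorm q1 lam0).
    by case: (klin _ y w) => -[].
  - by move=> y _; rewrite /lin (LP y).2 subrr.
have [G [W [kG GP WP]]] : exists G W, [/\ kval w G W,
    forall x, 0 <= G x /\ forall y, y \in ys -> lin y x <= G x &
    vle W (phi (vwlq q lam v))].
  elim: ys {ysP} => [|y ys [G [W [kG GP WP]]]].
    exists (fun=> 0), 0; split; [exact: kval0|by []|].
    by apply: phi_pos; exact: vwlq_ge0.
  exists (fun x => Num.max (lin y x) (G x)), (vjoin (\sum_j L y j *: w j) W).
  split; first exact: kval_max.
    move=> x; have [G0 Gy] := GP x; split; first by rewrite le_max G0 orbT.
    move=> z; rewrite inE => /predU1P[->|zys]; first by rewrite le_max lexx.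
    by rewrite le_max Gy ?orbT.
  apply: vjoin_lub => //.
  (* A linear form commutes with [phi], unlike a join; the bound by the l^q expression of [v] is
     then taken in [E] and pushed forward by positivity. *)
  have -> : \sum_j L y j *: w j = phi (\sum_j L y j *: v j).
    by rewrite linear_sum; apply: eq_bigr => j _; rewrite linearZ.
  apply: positive_op_le.
  have kv j : kval v (fun x => x ord0 j) (v j) := kval_coord v j.
  apply: (kval_le (kval_sum _ (fun j => kval_scale (L y j) (kv j))) (kval_vwlq q1 lam0 kv)).
  by move=> x; exact: (LP y).1.
apply: (@vle_trans _ _ (W + e *: vl1 w)); last by apply: vleD => //; exact: vle_refl.
apply: (kval_le (kval_vwlq q1 lam0 kw) (kval_add kG (kval_scale e kl1))).
have [kG' _] := kval_add kG (kval_scale e kl1).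
apply: (krivine_fun_le (krivine_fun_wnorm q1 lam0) kG') => x Sx.
have [y yys] := ysP x Sx; rewrite Sx mulr1.
by have := (GP x).2 y yys; lra.
Qed.

(** Nonnegative vectors are fixed by the modulus, and the modulus is continuous, so [x] is fixed
    too. *)
Lemma vge0_closed (V : banachLatticeType R) (x : V) :
  (forall e : R, 0 < e -> exists2 p : V, vle 0 p & `|x - p| <= e) -> vle 0 x.
Proof.
move=> xP; suff -> : x = vabs x by exact: vabs_ge0.
apply/eqP; rewrite -subr_eq0 -normr_eq0 eq_le normr_ge0 andbT.
apply/ler_addgt0Pl => e e0; rewrite addr0.
have [p p0 xp] := xP (e / 3) (divr_gt0 e0 (ltr0n R 3)).
have : `|x - vabs x| <= `|x - p| + `|p - vabs x|.
  by rewrite -[x - vabs x](subrKA p) ler_normD.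
have := norm_vjoin_lipschitz p (- p) x (- x).
rewrite -/(vabs p) -/(vabs x) (vabs_id p0) -opprD normrN.
rewrite [`|p - x|]distrC; lra.
Qed.

(** If [phi] were unbounded, there would be small nonnegative [y k] with large images. Their series
    converges by completeness to some [w] above every [y k], and positivity makes the norm of
    [phi w] exceed every integer. *)
Lemma positive_op_bounded : exists2 k, 0 <= k & forall x, `|phi x| <= k * `|x|.
Proof.
apply: contrapT => unbounded.
(* The inverses of these products telescope as 1/(k+1) - 1/(k+2), which yields the rate required by
   [harmonic_limit]. *)
have K0 (k : nat) : 0 < k.+1%:R * k.+2%:R :> R by rewrite mulr_gt0.
have /boolp.choice[y yP] : forall k : nat, exists y : E,
    [/\ vle 0 y, `|y| <= (k.+1%:R * k.+2%:R)^-1 & k%:R < `|phi y|].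
  move=> k; have [x xP] : exists x, k%:R * (k.+1%:R * k.+2%:R) * `|x| < `|phi x|.
    apply: contrapT => /forallNP h; apply: unbounded.
    exists (k%:R * (k.+1%:R * k.+2%:R)); first by rewrite mulr_ge0 // ltW.
    by move=> x; rewrite leNgt; apply/negP.
  have x0 : 0 < `|x|.
    rewrite normr_gt0; apply/eqP => x0.
    by move: xP; rewrite x0 linear0 !normr0 mulr0 ltxx.
  pose t : R := (k.+1%:R * k.+2%:R * `|x|)^-1.
  have t0 : 0 < t by rewrite invr_gt0 mulr_gt0.
  exists (t *: vabs x); split.
  - by apply: vscale_ge0; [exact: ltW|exact: vabs_ge0].
  - rewrite normrZ norm_vabs (gtr0_norm t0) /t invfM -mulrA mulVf ?mulr1 //.
    by rewrite gt_eqF.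
  - rewrite linearZ normrZ (gtr0_norm t0) mulrC ltr_pdivlMr ?mulr_gt0 // mulrA.
    apply: lt_le_trans xP _.
    rewrite -[leRHS]norm_vabs; apply: le_vabs_norm.
    by apply: vle_trans (positive_op_vabs x) _; exact: vabs_ub.
pose s k := \sum_(i < k) y i.
have sB k l : (k <= l)%N -> vle 0 (s l - s k) /\
    `|s l - s k| <= k.+1%:R^-1 - l.+1%:R^-1.
  elim: l => [|l IH].
    by rewrite leqn0 => /eqP ->; rewrite !subrr normr0; split=> //; exact: vle_refl.
  rewrite leq_eqVlt => /predU1P[->|kl].
    by rewrite !subrr normr0; split=> //; exact: vle_refl.
  have [IH1 IH2] := IH kl; have [y0 yn _] := yP l.
  have -> : s l.+1 - s k = (s l - s k) + y l by rewrite /s big_ord_recr /= addrAC.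
  split; first by rewrite -[0]addr0; exact: vleD.
  apply: le_trans (ler_normD _ _) _; apply: le_trans (lerD IH2 yn) _.
  have -> : (l.+1%:R * l.+2%:R)^-1 = l.+1%:R^-1 - l.+2%:R^-1 :> R.
    have : l.+1%:R + 1 != 0 :> R by rewrite natr1 pnatr_eq0.
    have : l.+1%:R != 0 :> R by rewrite pnatr_eq0.
    rewrite -[l.+2%:R]natr1; move: (l.+1%:R) => t t0 t1.
    by field; rewrite t0 t1.
  by rewrite addrA subrK.
have [w wP] : exists w, forall k, ball (s k) (2 * (1 / k.+1%:R)) w.
  apply: (@harmonic_limit R E s) => // k l; rewrite -ball_normE /= !mul1r.
  have pos m : 0 < m.+1%:R^-1 :> R by rewrite invr_gt0.
  have := pos k; have := pos l.
  have [/sB[_]|/ltnW /sB[_]] := leqP k l; first rewrite distrC;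
    move: (`|_|) (k.+1%:R^-1) (l.+1%:R^-1) => d a b; lra.
have sw k : vle 0 (w - s k).
  apply: vge0_closed => e e0.
  have [K hK] := harmonic_lt 2 e0.
  exists (s (maxn k K) - s k); first by case: (sB k _ (leq_maxl k K)).
  have := wP (maxn k K); rewrite -ball_normE /= distrC => /ltW.
  rewrite opprB addrA subrK => /le_trans; apply.
  by rewrite mul1r ltW // hK // leq_maxr.
have yw k : vle (y k) w.
  have := sw k.+1; rewrite vsubr_ge0; apply: vle_trans.
  rewrite /s big_ord_recr /= -[X in vle X _]add0r; apply: vle_add.
  by apply: vsum_ge0 => i _; case: (yP i).
have phiy k : k%:R < `|phi w|.
  have [y0 _ /lt_le_trans] := yP k; apply; apply: le_vabs_norm.
  by rewrite vabs_id; [exact: positive_op_le|exact: phi_pos].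
have := phiy (Num.truncn `|phi w|).+1.
by rewrite ltNge ltW // truncnS_gt.
Qed.

End positive_operators.

(** * The seminorm of a Lipschitz q-concave map *)

Record lattice_seminorm (R : realType) (E : banachLatticeType R) :=
  LatticeSeminorm {
    lsn :> E -> R ;
    lsn_add : forall x y, lsn (x + y) <= lsn x + lsn y ;
    lsn_scale : forall a x, lsn (a *: x) = `|a| * lsn x ;
    lsn_mono : forall x y, vle (vabs x) (vabs y) -> lsn x <= lsn y }.

Section concave_seminorm.
Context {R : realType} {E : banachLatticeType R} {X : metricType R}.
Context (q : \bar R) (q1 : (1 <= q)%E) (T : E -> X) (C : R).
Context (TC : lip_concave_bound q T C).

(* The weights are positive, rather than nonnegative, because the pieces of
   [vwlq_decomposition] are not controlled where the weight vanishes. *)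
Definition increments (x : E) : set R := [set a | exists n (lam : 'I_n -> R)
  (v v' : 'I_n -> E), [/\ forall j, 0 < lam j,
    vle (vwlq q lam (fun j => v j - v' j)) (vabs x) &
    a = wlq q lam (fun j => mdist (T (v j)) (T (v' j)))]].

Definition concave_seminorm x := sup (increments x).

Lemma increments_single v v' : increments (v - v') (mdist (T v) (T v')).
Proof.
exists 1%N, (fun=> 1), (fun=> v), (fun=> v'); split=> //.
  by rewrite vwlq_single //; exact: vle_refl.
by rewrite wlq_single // mdist_ge0.
Qed.

Lemma increments0 x : increments x 0.
Proof.
exists 1%N, (fun=> 1), (fun=> 0), (fun=> 0); split=> //.
  by rewrite vwlq_single // subrr vabs0; exact: vabs_ge0.
by rewrite wlq_single // mdistxx.
Qed.

Lemma increments_le x a : increments x a -> a <= C * `|x|.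
Proof.
move=> [n [lam [v [v' [lam0 vx ->]]]]]; have [C0 hC] := TC.
have lam0' j : 0 <= lam j by exact: ltW.
apply: le_trans (hC n v v' lam lam0') _; rewrite ler_wpM2l //.
rewrite -[leRHS]norm_vabs; apply: le_vabs_norm.
by rewrite vabs_id //; exact: vwlq_ge0.
Qed.

Lemma increments_has_sup x : has_sup (increments x).
Proof.
split; first by exists 0; exact: increments0.
by exists (C * `|x|) => a /increments_le.
Qed.

Lemma concave_seminorm_ge x a : increments x a -> a <= concave_seminorm x.
Proof. by move=> xa; apply: sup_upper_bound => //; exact: increments_has_sup. Qed.

Lemma concave_seminorm_le x M : (forall a, increments x a -> a <= M) ->
  concave_seminorm x <= M.
Proof. by move=> xM; apply: ge_sup => //; exists 0; exact: increments0. Qed.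

Lemma concave_seminorm_ge0 x : 0 <= concave_seminorm x.
Proof. exact/concave_seminorm_ge/increments0. Qed.

Lemma concave_seminorm_bound x : concave_seminorm x <= C * `|x|.
Proof. by apply: concave_seminorm_le => a; exact: increments_le. Qed.

Lemma concave_seminorm_mono x y : vle (vabs x) (vabs y) ->
  concave_seminorm x <= concave_seminorm y.
Proof.
move=> xy; apply: concave_seminorm_le => a [n [lam [v [v' [lam0 vx ->]]]]].
apply: concave_seminorm_ge; exists n, lam, v, v'; split => //.
exact: vle_trans xy.
Qed.

(** Splitting each difference as [z1 j + z2 j] gives the intermediate points [w j = v j - z1 j]. The
    triangle inequality in [X] and Minkowski then separate the increments into a family for [x] and
    one for [y]. *)
Lemma concave_seminorm_add x y :
  concave_seminorm (x + y) <= concave_seminorm x + concave_seminorm y.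
Proof.
apply: concave_seminorm_le => a [n [lam [v [v' [lam0 vxy ->]]]]].
have lam0' j : 0 <= lam j by exact: ltW.
have [z1 [z2 [zE z1x z2y]]] :=
  vwlq_decomposition q1 lam0 (vle_trans _ _ _ vxy (vabsD x y)).
pose w j := v j - z1 j.
have wE j : w j - v' j = z2 j by rewrite /w addrAC zE addrAC subrr add0r.
apply: (@le_trans _ _ (wlq q lam (fun j =>
    mdist (T (v j)) (T (w j)) + mdist (T (w j)) (T (v' j))))).
  by apply: wlq_le => // j; rewrite mdist_ge0 metric_triangle.
apply: le_trans (wlq_add q1 lam0' _ _) _; try by move=> j; exact: mdist_ge0.
apply: lerD; apply: concave_seminorm_ge.
  exists n, lam, v, w; split=> //.
  by under eq_fun do rewrite opprB addrC subrK.
by exists n, lam, w, v'; split=> //; under eq_fun do rewrite wE.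
Qed.

(** Only the weights are rescaled, the points of the family being kept. One inequality for positive
    scalars suffices, as the reverse one is its instance at the inverse scalar. *)
Lemma concave_seminorm_scale a x :
  concave_seminorm (a *: x) = `|a| * concave_seminorm x.
Proof.
have pos t y : 0 < t -> t * concave_seminorm y <= concave_seminorm (t *: y).
  move=> t0; rewrite -ler_pdivlMl //; apply: concave_seminorm_le.
  move=> b [n [lam [v [v' [lam0 vy ->]]]]]; rewrite ler_pdivlMl //.
  have lam0' j : 0 <= lam j by exact: ltW.
  have [mu [mu0 muE]] := wlq_rescale q1 lam0 t0.
  have mu0' j : 0 <= mu j by exact: ltW.
  rewrite -muE; last by move=> j; exact: mdist_ge0.
  apply: concave_seminorm_ge; exists n, mu, v, v'; split => //.
  rewrite (vwlq_rescale q1 lam0' mu0' muE) vabsZ gtr0_norm //.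
  by apply: vle_scale => //; exact: ltW.
have posE t y : 0 < t -> concave_seminorm (t *: y) = t * concave_seminorm y.
  move=> t0; apply/eqP; rewrite eq_le pos // andbT -ler_pdivrMl //.
  by have := pos t^-1 (t *: y); rewrite invr_gt0 scalerK ?gt_eqF // => ->.
have [a0|a0|->] := ltgtP a 0; last first.
- apply/eqP; rewrite scale0r normr0 mul0r eq_le concave_seminorm_ge0 andbT.
  by have := concave_seminorm_bound 0; rewrite normr0 mulr0.
- by rewrite posE // gtr0_norm.
- rewrite ltr0_norm // -posE ?oppr_gt0 //; apply/eqP; rewrite eq_le.
  by apply/andP; split; apply: concave_seminorm_mono; rewrite scaleNr vabsN;
    exact: vle_refl.
Qed.

Lemma concave_seminorm_concave n (x : 'I_n -> E) :
  wlq q (fun=> 1) (fun k => concave_seminorm (x k)) <=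
  concave_seminorm (vwlq q (fun=> 1) x).
Proof.
have one0 : forall j : 'I_n, 0 <= (1 : R) by [].
have [c c0 cP] := wlq_le_sum q1 one0.
apply/ler_addgt0Pl => e e0.
have cn : 0 < c * n%:R + 1 by rewrite ltr_wpDl // mulr_ge0.
(* An error [d] in each of the [n] seminorms costs at most [c * n * d] in the l^q norm; the added 1
   keeps the denominator positive. *)
pose d := e / (c * n%:R + 1); have d0 : 0 < d by rewrite divr_gt0.
have /boolp.choice[a aP] : forall k, exists a,
    increments (x k) a /\ concave_seminorm (x k) <= a + d.
  move=> k; have [a ka da] := sup_adherent d0 (increments_has_sup (x k)).
  by exists a; split => //; rewrite -lerBlDr ltW.
have a0 k : 0 <= a k.
  by have [[m [lam [v [v' [_ _ ->]]]]] _] := aP k; exact: wlq_ge0.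
(* The length is isolated because the types of the weights and points depend on it: it is chosen
   first, and the families afterwards. *)
have fam_ex : forall k, exists N : nat,
    exists p : ('I_N -> R) * (('I_N -> E) * ('I_N -> E)),
    [/\ forall j, 0 < p.1 j,
      vle (vwlq q p.1 (fun j => p.2.1 j - p.2.2 j)) (vabs (x k)) &
      a k = wlq q p.1 (fun j => mdist (T (p.2.1 j)) (T (p.2.2 j)))].
  by move=> k; have [[m [lam [v [v' h]]]] _] := aP k; exists m, (lam, (v, v')).
have /boolp.choice[N NP] := fam_ex.
pose F k := projT1 (cid (NP k)).
have FP k := projT2 (cid (NP k)).
pose lam k := (F k).1; pose v k := (F k).2.1; pose v' k := (F k).2.2.
have lam0 k j : 0 < lam k j by have [h _ _] := FP k; exact: h.
have lam0' k j : 0 <= lam k j by exact: ltW.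
have vx k : vle (vwlq q (lam k) (fun j => v k j - v' k j)) (vabs (x k)).
  by have [_ h _] := FP k; exact: h.
have aE k : a k = wlq q (lam k) (fun j => mdist (T (v k j)) (T (v' k j))).
  by have [_ _ h] := FP k; exact: h.
clearbody lam v v'.
apply: (@le_trans _ _ (wlq q (fun=> 1) (fun k => a k + d))).
  by apply: wlq_le => // k; rewrite concave_seminorm_ge0; case: (aP k).
apply: le_trans (wlq_add q1 one0 a0 (fun=> ltW d0)) _.
rewrite addrC; apply: lerD.
  apply: le_trans (cP _ (fun=> ltW d0)) _.
  rewrite sumr_const card_ord -mulr_natr mulrCA.
  have <- : d * (c * n%:R + 1) = e by rewrite divfK ?gt_eqF.
  by rewrite ler_wpM2l ?lerDl // ltW.
apply: concave_seminorm_ge.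
rewrite (_ : a = fun k => wlq q (lam k) (fun j => mdist (T (v k j)) (T (v' k j))));
  last exact/funext.
rewrite -(@wlq_flatten _ q _ N lam (fun k j => mdist (T (v k j)) (T (v' k j)))
  q1 lam0' (fun _ _ => mdist_ge0 _ _)).
pose p (i : 'I_#|{: {k : 'I_n & 'I_(N k)}}|) := enum_val i.
exists #|{: {k : 'I_n & 'I_(N k)}}|, (fun i => lam _ (tagged (p i))).
exists (fun i => v _ (tagged (p i))), (fun i => v' _ (tagged (p i))).
split=> //.
rewrite (@vwlq_flatten _ q q1 _ N lam E (fun k j => v k j - v' k j)) //.
apply: vle_trans (vabs_ub _); apply: vwlq_le => // k.
by rewrite vabs_id //; exact: vwlq_ge0.
Qed.

Lemma lip_concave_seminorm : exists rho : lattice_seminorm E,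
  [/\ forall x, rho x <= C * `|x|,
      forall x y, mdist (T x) (T y) <= rho (x - y) &
      forall n (x : 'I_n -> E), wlq q (fun=> 1) (fun k => rho (x k)) <=
        rho (vwlq q (fun=> 1) x)].
Proof.
exists (LatticeSeminorm concave_seminorm_add concave_seminorm_scale
  concave_seminorm_mono); split => /=.
- exact: concave_seminorm_bound.
- by move=> x y; apply: concave_seminorm_ge; exact: increments_single.
- exact: concave_seminorm_concave.
Qed.

End concave_seminorm.

(** * Completion with respect to a lattice seminorm *)

Section seminorm_theory.
Context {R : realType} {E : banachLatticeType R} (rho : lattice_seminorm E).
Implicit Types x y z w : E.

Lemma lsn0 : rho 0 = 0.
Proof. by rewrite -(scale0r 0) lsn_scale normr0 mul0r. Qed.

Lemma lsnN x : rho (- x) = rho x.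
Proof. by rewrite -scaleN1r lsn_scale normrN1 mul1r. Qed.

Lemma lsn_distC x y : rho (x - y) = rho (y - x).
Proof. by rewrite -lsnN opprB. Qed.

Lemma lsn_ge0 x : 0 <= rho x.
Proof. by have := lsn_add rho x (- x); rewrite subrr lsn0 lsnN; lra. Qed.

Lemma lsn_triangle y x z : rho (x - z) <= rho (x - y) + rho (y - z).
Proof. by rewrite -[x - z](subrKA y) lsn_add. Qed.

Lemma lsn_dist x y : `|rho x - rho y| <= rho (x - y).
Proof.
have := lsn_add rho (x - y) y; have := lsn_add rho (y - x) x.
by rewrite !subrK lsn_distC ler_norml => ? ?; apply/andP; split; lra.
Qed.

Lemma lsn_vabs x : rho (vabs x) = rho x.
Proof.
by apply/eqP; rewrite eq_le; apply/andP; split; apply: lsn_mono;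
  rewrite vabs_abs; exact: vle_refl.
Qed.

Lemma lsn_vjoin x y z w :
  rho (vjoin x y - vjoin z w) <= rho (x - z) + rho (y - w).
Proof.
rewrite -[rho (x - z)]lsn_vabs -[rho (y - w)]lsn_vabs.
apply: le_trans (lsn_add rho _ _); apply: lsn_mono.
by apply: vle_trans (vjoin_lipschitz _ _ _ _) _; exact: vabs_ub.
Qed.

Definition cauchy_sequence (a : nat -> E) := forall e : R, 0 < e ->
  exists N, forall m n, (N <= m)%N -> (N <= n)%N -> rho (a m - a n) < e.

Definition null_distance (a b : nat -> E) := forall e : R, 0 < e ->
  exists N, forall n, (N <= n)%N -> rho (a n - b n) < e.

Lemma null_distance_refl a : null_distance a a.
Proof. by move=> e e0; exists 0%N => n _; rewrite subrr lsn0. Qed.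

Lemma null_distance_sym a b : null_distance a b -> null_distance b a.
Proof.
by move=> ab e /ab[N NP]; exists N => n /NP; rewrite lsn_distC.
Qed.

Lemma null_distance_trans b a c :
  null_distance a b -> null_distance b c -> null_distance a c.
Proof.
move=> ab bc e e0; have e20 : 0 < e / 2 by rewrite divr_gt0.
have [N NP] := ab _ e20; have [M MP] := bc _ e20.
exists (maxn N M) => n; rewrite geq_max => /andP[/NP h1 /MP h2].
apply: le_lt_trans (lsn_triangle (b n) _ _) _.
by rewrite [ltRHS]splitr ltrD.
Qed.

(** One condition covering sums, multiples and joins, so that all three pass to the completion by
    the same lemmas. *)
Definition lipschitz_op (op : E -> E -> E) := exists2 c, 0 < c &
  forall x y z w, rho (op x y - op z w) <= c * (rho (x - z) + rho (y - w)).

Lemma cauchy_sequence_op op a b : lipschitz_op op ->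
  cauchy_sequence a -> cauchy_sequence b ->
  cauchy_sequence (fun n => op (a n) (b n)).
Proof.
move=> [c c0 opc] ca cb e e0.
have d0 : 0 < e / c / 2 by rewrite !divr_gt0.
have [N NP] := ca _ d0; have [M MP] := cb _ d0.
exists (maxn N M) => m n; rewrite !geq_max => /andP[m1 m2] /andP[n1 n2].
apply: le_lt_trans (opc _ _ _ _) _.
rewrite -ltr_pdivlMl // mulrC [ltRHS]splitr.
by apply: ltrD; [exact: NP|exact: MP].
Qed.

Lemma null_distance_op op a b a' b' : lipschitz_op op ->
  null_distance a a' -> null_distance b b' ->
  null_distance (fun n => op (a n) (b n)) (fun n => op (a' n) (b' n)).
Proof.
move=> [c c0 opc] ca cb e e0.
have d0 : 0 < e / c / 2 by rewrite !divr_gt0.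
have [N NP] := ca _ d0; have [M MP] := cb _ d0.
exists (maxn N M) => n; rewrite !geq_max => /andP[n1 n2].
apply: le_lt_trans (opc _ _ _ _) _.
rewrite -ltr_pdivlMl // mulrC [ltRHS]splitr.
by apply: ltrD; [exact: NP|exact: MP].
Qed.

Definition representative (a : nat -> E) : nat -> E :=
  xget (fun=> 0) [set b | cauchy_sequence b /\ null_distance a b].

Lemma representativeP a : cauchy_sequence a ->
  cauchy_sequence (representative a) /\ null_distance a (representative a).
Proof.
move=> ca; apply: (@xgetPex _ (fun=> 0)
  [set b | cauchy_sequence b /\ null_distance a b]).
by exists a; split => //; exact: null_distance_refl.
Qed.

(** Equivalent sequences define the same set of candidates, from which [xget] makes the same
    choice. *)
Lemma representative_eq a b : null_distance a b ->
  representative a = representative b.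
Proof.
move=> ab; congr xget; apply/seteqP; split => c [cc h]; split => //.
  exact: null_distance_trans (null_distance_sym ab) h.
exact: null_distance_trans ab h.
Qed.

End seminorm_theory.

(* Each class of Cauchy sequences is represented by a chosen member, so that
   equality in the completion is Leibniz equality. *)
Definition completion (R : realType) (E : banachLatticeType R)
    (rho : lattice_seminorm E) : Type :=
  {a : nat -> E | cauchy_sequence rho a /\ representative rho a = a}.

Section completion.
Context {R : realType} {E : banachLatticeType R} (rho : lattice_seminorm E).
Local Notation V := (completion rho).
Implicit Types (a b : nat -> E) (x y z : V).

HB.instance Definition _ := gen_eqMixin V.
HB.instance Definition _ := gen_choiceMixin V.

Lemma sval_cauchy x : cauchy_sequence rho (sval x).
Proof. by case: x => a []. Qed.

Lemma sval_null_inj x y : null_distance rho (sval x) (sval y) -> x = y.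
Proof.
case: x y => a pa [b pb] /= /representative_eq; rewrite pa.2 pb.2 => ab.
by subst b; congr exist; exact: Prop_irrelevance.
Qed.

Lemma cauchy_cst (u : E) : cauchy_sequence rho (fun=> u).
Proof. by move=> e e0; exists 0%N => m n _ _; rewrite subrr lsn0. Qed.

Lemma limit_exists a : cauchy_sequence rho a ->
  exists x, null_distance rho a (sval x).
Proof.
move=> ca; have [cr ar] := representativeP ca.
by exists (exist _ (representative rho a)
  (conj cr (esym (representative_eq ar)))).
Qed.

Definition climit a : V :=
  xget (sval (cid (limit_exists (cauchy_cst 0))))
    [set x | null_distance rho a (sval x)].

Lemma climitP a : cauchy_sequence rho a -> null_distance rho a (sval (climit a)).
Proof.
move=> /limit_exists ax.
rewrite /climit; set d := sval (cid _).
exact: (@xgetPex _ d [set x | null_distance rho a (sval x)] ax).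
Qed.

Lemma climit_eq a b : cauchy_sequence rho a -> cauchy_sequence rho b ->
  null_distance rho a b -> climit a = climit b.
Proof.
move=> /climitP ca /climitP cb ab; apply: sval_null_inj.
apply: null_distance_trans cb; apply: null_distance_trans ab.
exact: null_distance_sym.
Qed.

Lemma climit_sval x : climit (sval x) = x.
Proof.
by apply/sval_null_inj/null_distance_sym/climitP; exact: sval_cauchy.
Qed.

(** Reduces identities in the completion to termwise identities of sequences. *)
Lemma climitW (P : V -> Prop) :
  (forall a, cauchy_sequence rho a -> P (climit a)) -> forall x, P x.
Proof. by move=> PC x; rewrite -(climit_sval x); apply: PC; exact: sval_cauchy. Qed.

Definition clift (op : E -> E -> E) x y : V :=
  climit (fun n => op (sval x n) (sval y n)).

Lemma clift_climit op a b : lipschitz_op rho op ->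
  cauchy_sequence rho a -> cauchy_sequence rho b ->
  clift op (climit a) (climit b) = climit (fun n => op (a n) (b n)).
Proof.
move=> opl ca cb; apply: climit_eq.
- by apply: cauchy_sequence_op => //; exact: sval_cauchy.
- exact: cauchy_sequence_op.
- by apply: null_distance_op => //; apply/null_distance_sym/climitP.
Qed.

Lemma lipschitz_add : lipschitz_op rho +%R.
Proof.
exists 1 => // x y z w; rewrite mul1r opprD addrACA; exact: lsn_add.
Qed.

(** A dummy second argument fits scaling into [lipschitz_op], and the constant is [|c| + 1] because
    it must be positive even for [c = 0]. *)
Lemma lipschitz_scale (c : R) : lipschitz_op rho (fun u _ => c *: u).
Proof.
exists (`|c| + 1) => [|x y z w]; first by rewrite ltr_wpDl.
rewrite -scalerBr lsn_scale; apply: ler_pM; rewrite ?normr_ge0 ?lsn_ge0 //.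
  by rewrite lerDl.
by rewrite lerDl lsn_ge0.
Qed.

Lemma lipschitz_vjoin : lipschitz_op rho vjoin.
Proof. by exists 1 => // x y z w; rewrite mul1r; exact: lsn_vjoin. Qed.

Definition cadd := clift +%R.
Definition cscale (c : R) x := clift (fun u _ => c *: u) x x.
Definition cjoin := clift vjoin.

Lemma caddE a b : cauchy_sequence rho a -> cauchy_sequence rho b ->
  cadd (climit a) (climit b) = climit (fun n => a n + b n).
Proof. by move=> ca cb; exact: (clift_climit lipschitz_add). Qed.

Lemma cscaleE c a : cauchy_sequence rho a ->
  cscale c (climit a) = climit (fun n => c *: a n).
Proof. by move=> ca; exact: (clift_climit (lipschitz_scale c)). Qed.

Lemma cjoinE a b : cauchy_sequence rho a -> cauchy_sequence rho b ->
  cjoin (climit a) (climit b) = climit (fun n => vjoin (a n) (b n)).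
Proof. by move=> ca cb; exact: (clift_climit lipschitz_vjoin). Qed.

Lemma cauchy_add a b : cauchy_sequence rho a -> cauchy_sequence rho b ->
  cauchy_sequence rho (fun n => a n + b n).
Proof. exact/cauchy_sequence_op/lipschitz_add. Qed.

Lemma cauchy_scale c a : cauchy_sequence rho a ->
  cauchy_sequence rho (fun n => c *: a n).
Proof. by move=> ca; exact: (cauchy_sequence_op (lipschitz_scale c) ca ca). Qed.

Lemma cauchy_vjoin a b : cauchy_sequence rho a -> cauchy_sequence rho b ->
  cauchy_sequence rho (fun n => vjoin (a n) (b n)).
Proof. exact/cauchy_sequence_op/lipschitz_vjoin. Qed.

Lemma caddA : associative cadd.
Proof.
elim/climitW => a ca; elim/climitW => b cb; elim/climitW => c cc.
rewrite !caddE //; try exact: cauchy_add.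
by congr climit; apply/funext => n; rewrite addrA.
Qed.

Lemma caddC : commutative cadd.
Proof.
elim/climitW => a ca; elim/climitW => b cb; rewrite !caddE //.
by congr climit; apply/funext => n; rewrite addrC.
Qed.

Definition czero := climit (fun=> 0).

Lemma cadd0 : left_id czero cadd.
Proof.
elim/climitW => a ca; rewrite caddE //; last exact: cauchy_cst.
by congr climit; apply/funext => n; rewrite add0r.
Qed.

Definition copp := cscale (-1).

Lemma caddN : left_inverse czero copp cadd.
Proof.
elim/climitW => a ca; rewrite /copp cscaleE // caddE //; last exact: cauchy_scale.
by congr climit; apply/funext => n; rewrite scaleN1r addNr.
Qed.

HB.instance Definition _ := GRing.isZmodule.Build V caddA caddC cadd0 caddN.

Lemma climitD a b : cauchy_sequence rho a -> cauchy_sequence rho b ->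
  climit a + climit b = climit (fun n => a n + b n).
Proof. exact: caddE. Qed.

Lemma cscaleA (c d : R) x : cscale c (cscale d x) = cscale (c * d) x.
Proof.
elim/climitW: x => a ca; rewrite !cscaleE //; last exact: cauchy_scale.
by congr climit; apply/funext => n; rewrite scalerA.
Qed.

Lemma cscale1 : left_id 1 cscale.
Proof.
elim/climitW => a ca; rewrite cscaleE //.
by congr climit; apply/funext => n; rewrite scale1r.
Qed.

Lemma cscaleDr : right_distributive cscale +%R.
Proof.
move=> c; elim/climitW => a ca; elim/climitW => b cb.
rewrite climitD // !cscaleE //; last exact: cauchy_add.
rewrite climitD //; try exact: cauchy_scale.
by congr climit; apply/funext => n; rewrite scalerDr.
Qed.

Lemma cscaleDl x : {morph cscale^~ x : c d / c + d}.
Proof.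
move=> c d; elim/climitW: x => a ca; rewrite !cscaleE //.
rewrite climitD //; try exact: cauchy_scale.
by congr climit; apply/funext => n; rewrite scalerDl.
Qed.

HB.instance Definition _ := GRing.Zmodule_isLmodule.Build R V
  cscaleA cscale1 cscaleDr cscaleDl.

Lemma climitZ c a : cauchy_sequence rho a ->
  c *: climit a = climit (fun n => c *: a n).
Proof. exact: cscaleE. Qed.

Lemma climitN a : cauchy_sequence rho a ->
  - climit a = climit (fun n => - a n).
Proof.
move=> ca; rewrite -scaleN1r climitZ //.
by congr climit; apply/funext => n; rewrite scaleN1r.
Qed.

Definition cnorm x : R := lim (rho (sval x n) @[n --> \oo]).

Lemma cnorm_climit a : cauchy_sequence rho a -> forall e, 0 < e ->
  exists N, forall n, (N <= n)%N -> `|cnorm (climit a) - rho (a n)| < e.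
Proof.
move=> ca e e0; have e20 : 0 < e / 2 by rewrite divr_gt0.
have [N NP] := climitP ca e20.
have : cvg (rho (sval (climit a) n) @[n --> \oo]).
  apply: cauchy_cvg; apply: cauchy_exP => d d0.
  have [M MP] := @sval_cauchy (climit a) d d0.
  exists (rho (sval (climit a) M)); exists M => // n Mn.
  by rewrite -ball_normE /=; apply: le_lt_trans (lsn_dist _ _ _) _; exact: MP.
move=> /cvgrPdist_lt /(_ _ e20) [M _ MP]; exists (maxn N M) => n.
rewrite geq_max => /andP[Nn Mn].
rewrite -[X in `|X|](subrKA (rho (sval (climit a) n))).
apply: le_lt_trans (ler_normD _ _) _; rewrite [ltRHS]splitr ltrD //.
  exact: MP.
apply: le_lt_trans (lsn_dist _ _ _) _; rewrite lsn_distC; exact: NP.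
Qed.

Lemma cnorm_le a M : cauchy_sequence rho a ->
  (forall e, 0 < e -> exists N, forall n, (N <= n)%N -> rho (a n) <= M + e) ->
  cnorm (climit a) <= M.
Proof.
move=> ca aM; apply/ler_addgt0Pl => e e0.
have e20 : 0 < e / 2 by rewrite divr_gt0.
have [N NP] := cnorm_climit ca e20; have [K KP] := aM _ e20.
have := NP _ (leq_maxl N K); have := KP _ (leq_maxr N K).
rewrite ltr_norml => ? /andP[? ?]; lra.
Qed.

Lemma cnormD x y : cnorm (x + y) <= cnorm x + cnorm y.
Proof.
elim/climitW: x => a ca; elim/climitW: y => b cb; rewrite climitD //.
apply: cnorm_le => [|e e0]; first exact: cauchy_add.
have e20 : 0 < e / 2 by rewrite divr_gt0.
have [N NP] := cnorm_climit ca e20; have [K KP] := cnorm_climit cb e20.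
exists (maxn N K) => n; rewrite geq_max => /andP[/NP + /KP].
rewrite !ltr_norml => /andP[? ?] /andP[? ?].
by apply: le_trans (lsn_add _ _ _) _; lra.
Qed.

Lemma cnormZ c x : cnorm (c *: x) = `|c| * cnorm x.
Proof.
elim/climitW: x => a ca; rewrite climitZ //.
have cca := cauchy_scale c ca.
apply/eqP; rewrite -subr_eq0 -normr_eq0 eq_le normr_ge0 andbT.
apply/ler_addgt0Pl => e e0; rewrite addr0.
have c1 : 0 < `|c| + 1 by rewrite ltr_wpDl.
pose d := e / (`|c| + 1) / 2; have d0 : 0 < d by rewrite !divr_gt0.
have [N NP] := cnorm_climit cca (divr_gt0 e0 (ltr0n R 2)).
have [K KP] := cnorm_climit ca d0.
have := NP _ (leq_maxl N K); have := KP _ (leq_maxr N K).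
move: (maxn N K) => n; rewrite lsn_scale => h1 h2.
rewrite -[X in `|X|](subrKA (`|c| * rho (a n))).
apply: le_trans (ler_normD _ _) _; rewrite [leRHS]splitr lerD //; first exact: ltW.
rewrite -mulrBr normrM normr_id distrC.
apply: (@le_trans _ _ ((`|c| + 1) * d)); last first.
  by rewrite /d mulrA mulrCA divff ?gt_eqF // mulr1.
by apply: ler_pM => //; [rewrite lerDl|exact: ltW].
Qed.

Lemma cnorm_eq0 x : cnorm x = 0 -> x = 0.
Proof.
elim/climitW: x => a ca x0; apply: climit_eq => //; first exact: cauchy_cst.
move=> e e0; have [N NP] := cnorm_climit ca e0.
by exists N => n /NP; rewrite x0 sub0r normrN subr0 ger0_norm ?lsn_ge0.
Qed.

HB.instance Definition _ := Lmodule_isNormed.Build R V cnormD cnormZ cnorm_eq0.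

Lemma norm_climit_le a M : cauchy_sequence rho a ->
  (forall e, 0 < e -> exists N, forall n, (N <= n)%N -> rho (a n) <= M + e) ->
  `|climit a| <= M.
Proof. exact: cnorm_le. Qed.

Definition cembed (u : E) : V := climit (fun=> u).

Lemma cembed_linear : linear cembed.
Proof.
move=> c u w; rewrite /cembed climitZ ?climitD //; exact: cauchy_cst.
Qed.

HB.instance Definition _ := GRing.isLinear.Build R E V *:%R cembed cembed_linear.

Lemma norm_cembed u : `|cembed u| = rho u.
Proof.
apply/eqP; rewrite -subr_eq0 -normr_eq0 eq_le normr_ge0 andbT.
apply/ler_addgt0Pl => e e0; rewrite addr0.
have [N NP] := cnorm_climit (cauchy_cst u) e0.
by apply/ltW/(NP N).
Qed.

Lemma cauchy_sub_cst a u : cauchy_sequence rho a ->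
  climit a - cembed u = climit (fun n => a n - u).
Proof.
move=> ca; rewrite -linearN climitD //; exact: cauchy_cst.
Qed.

Lemma cembed_dense x e : 0 < e -> exists u, `|x - cembed u| < e.
Proof.
elim/climitW: x => a ca e0; have e20 : 0 < e / 2 by rewrite divr_gt0.
have [N NP] := ca _ e20; exists (a N); rewrite cauchy_sub_cst //.
apply: (@le_lt_trans _ _ (e / 2)); last by rewrite [ltRHS]splitr ltrDl.
apply: norm_climit_le => [|d d0]; first exact: cauchy_add ca (cauchy_cst _).
exists N => n Nn; have := NP n N Nn (leqnn N); lra.
Qed.

(** By density, balls belonging to the Cauchy filter can be centred at embedded vectors [u k]; these
    form a Cauchy sequence for [rho], whose class is the limit. *)
Lemma completion_complete (F : set_system V) :
  ProperFilter F -> cauchy F -> cvg F.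
Proof.
move=> FF /cauchyP Fc.
have e0 k : 0 < k.+1%:R^-1 :> R by rewrite invr_gt0.
have /boolp.choice[u uP] : forall k : nat, exists u : E,
    F (ball (cembed u) (2 * k.+1%:R^-1)).
  move=> k; have [x xF] := Fc _ (e0 k); have [u xu] := cembed_dense x (e0 k).
  exists u; apply: filterS xF => y; rewrite -!ball_normE /= => xy.
  rewrite -[cembed u - y](subrKA x).
  apply: le_lt_trans (ler_normD _ _) _; rewrite mulr_natl mulr2n ltrD //.
  by rewrite distrC.
have uu k l : rho (u k - u l) < 2 * (k.+1%:R^-1 + l.+1%:R^-1).
  rewrite -norm_cembed linearB.
  have [y []] := filter_ex (filterI (uP k) (uP l)).
  rewrite -!ball_normE /= => ky ly.
  rewrite -[cembed (u k) - _](subrKA y).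
  apply: le_lt_trans (ler_normD _ _) _; rewrite mulrDr ltrD //.
  by rewrite distrC.
have cu : cauchy_sequence rho u.
  move=> e e1; have [K KP] := harmonic_lt 1 (divr_gt0 e1 (ltr0n R 4)).
  exists K => m n /KP + /KP; rewrite !mul1r => hm hn.
  apply: lt_le_trans (uu m n) _.
  move: hm hn; move: (m.+1%:R^-1) (n.+1%:R^-1) => p r; lra.
apply/cvg_ex; exists (climit u); apply/cvg_ballP => e e1.
have [K KP] := harmonic_lt 1 (divr_gt0 e1 (ltr0n R 4)).
have := KP K (leqnn K); rewrite mul1r => hK.
apply: filterS (uP K) => y; rewrite -!ball_normE /= => Ky.
rewrite -[climit u - y](subrKA (cembed (u K))).
apply: le_lt_trans (ler_normD _ _) _.
have : `|climit u - cembed (u K)| <= 2 * K.+1%:R^-1.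
  rewrite cauchy_sub_cst //; apply: norm_climit_le => [|d d0].
    exact: cauchy_add cu (cauchy_cst _).
  have [L LP] := harmonic_lt 2 d0; exists L => n /LP hn.
  apply/ltW; apply: lt_trans (uu n K) _.
  by rewrite mulrDr addrC ltrD2l.
move: Ky hK; move: (K.+1%:R^-1) => p; lra.
Qed.

HB.instance Definition _ := Uniform_isComplete.Build V completion_complete.

Lemma cjoinC : commutative cjoin.
Proof.
elim/climitW => a ca; elim/climitW => b cb; rewrite !cjoinE //.
by congr climit; apply/funext => n; rewrite vjoinC.
Qed.

Lemma cjoinA : associative cjoin.
Proof.
elim/climitW => a ca; elim/climitW => b cb; elim/climitW => c cc.
rewrite !cjoinE //; try exact: cauchy_vjoin.
by congr climit; apply/funext => n; rewrite vjoinA.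
Qed.

Lemma cjoinxx : idempotent_op cjoin.
Proof.
elim/climitW => a ca; rewrite cjoinE //.
by congr climit; apply/funext => n; rewrite vjoinxx.
Qed.

(** Stating the order as an equation lets its axioms be checked termwise; representatives of
    comparable classes need not be comparable. *)
Definition cle x y := cjoin x y = y.

Lemma cle_refl x : cle x x.
Proof. exact: cjoinxx. Qed.

Lemma cle_anti x y : cle x y -> cle y x -> x = y.
Proof. by rewrite /cle => xy yx; rewrite -xy -{1}yx cjoinC. Qed.

Lemma cle_trans y x z : cle x y -> cle y z -> cle x z.
Proof. by rewrite /cle => xy <-; rewrite cjoinA xy. Qed.

Lemma cjoinP x y z : cle (cjoin x y) z <-> cle x z /\ cle y z.
Proof.
rewrite /cle; split=> [<-|[xz yz]]; last by rewrite -cjoinA yz.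
split; first by rewrite !cjoinA cjoinxx.
by rewrite [cjoin x y]cjoinC !cjoinA cjoinxx.
Qed.

Lemma cle_add x y z : cle x y -> cle (x + z) (y + z).
Proof.
move=> xy; rewrite /cle -{2}xy; elim/climitW: x {xy} => a ca.
elim/climitW: y => b cb; elim/climitW: z => c cc.
rewrite (cjoinE ca cb) (climitD ca cc) (climitD cb cc).
rewrite (climitD (cauchy_vjoin ca cb) cc).
rewrite (cjoinE (cauchy_add ca cc) (cauchy_add cb cc)).
by congr climit; apply/funext => n; rewrite vjoinDr.
Qed.

Lemma cle_scale (c : R) x y : 0 <= c -> cle x y -> cle (c *: x) (c *: y).
Proof.
move=> c0 xy; rewrite /cle -{2}xy; elim/climitW: x {xy} => a ca.
elim/climitW: y => b cb.
rewrite (cjoinE ca cb) (climitZ c ca) (climitZ c cb).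
rewrite (climitZ c (cauchy_vjoin ca cb)).
rewrite (cjoinE (cauchy_scale c ca) (cauchy_scale c cb)).
by congr climit; apply/funext => n; rewrite vjoinZ.
Qed.

Lemma cauchy_opp a : cauchy_sequence rho a -> cauchy_sequence rho (fun n => - a n).
Proof.
move=> /(cauchy_scale (-1)); by under eq_fun do rewrite scaleN1r.
Qed.

Lemma cjoin_climitN a : cauchy_sequence rho a ->
  cjoin (climit a) (- climit a) = climit (fun n => vabs (a n)).
Proof. by move=> ca; rewrite climitN // cjoinE //; exact: cauchy_opp. Qed.

(** The hypothesis says that the joins of |a n| and |b n| have the same class as |b n|. Their
    seminorms dominate [rho (a n)] and tend to the norm of [climit b]. *)
Lemma cle_norm x y : cle (cjoin x (- x)) (cjoin y (- y)) -> `|x| <= `|y|.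
Proof.
elim/climitW: x => a ca; elim/climitW: y => b cb.
have cabs d : cauchy_sequence rho d -> cauchy_sequence rho (fun n => vabs (d n)).
  by move=> cd; apply: cauchy_vjoin => //; exact: cauchy_opp.
have ca' := cabs _ ca; have cb' := cabs _ cb.
rewrite !cjoin_climitN // /cle cjoinE // => /(congr1 (fun x => `|x|)) ab.
apply: norm_climit_le => // e e0; have e20 : 0 < e / 2 by rewrite divr_gt0.
have [N NP] := cnorm_climit (cauchy_vjoin ca' cb') e20.
have [K KP] := cnorm_climit cb' e20.
have [L LP] := cnorm_climit cb e20.
have nb : `|climit b| = `|climit (fun n => vabs (b n))|.
  apply/eqP; rewrite -subr_eq0 -normr_eq0 eq_le normr_ge0 andbT.
  apply/ler_addgt0Pl => d d0; rewrite addr0.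
  have d20 : 0 < d / 2 by rewrite divr_gt0.
  have [N1 NP1] := cnorm_climit cb d20; have [N2 NP2] := cnorm_climit cb' d20.
  have := NP1 _ (leq_maxl N1 N2); have := NP2 _ (leq_maxr N1 N2).
  rewrite lsn_vabs /Num.norm /= !ltr_norml ler_norml.
  by move=> /andP[? ?] /andP[? ?]; apply/andP; split; lra.
exists N => n Nn; have := NP n Nn; rewrite -/(`|climit _|).
rewrite -[cnorm _]/(`|climit (fun n => vjoin (vabs (a n)) (vabs (b n)))|) ab -nb.
have : rho (a n) <= rho (vjoin (vabs (a n)) (vabs (b n))).
  apply: lsn_mono; apply: vle_trans (vabs_ub _); exact: vjoin_ubl.
rewrite ltr_norml => ? /andP[? ?]; lra.
Qed.

HB.instance Definition _ := isBanachLattice.Build R V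
  cle_refl cle_anti cle_trans cjoinP cle_add cle_scale cle_norm.

Lemma cembed_vjoin : {morph cembed : u w / vjoin u w}.
Proof. by move=> u w; rewrite [RHS]cjoinE //; exact: cauchy_cst. Qed.

End completion.

Lemma lattice_seminorm_completion (R : realType) (E : banachLatticeType R)
    (rho : lattice_seminorm E) :
  exists (V : banachLatticeType R) (phi : {linear E -> V}),
    [/\ lattice_hom phi, forall u, `|phi u| = rho u &
      forall x e, 0 < e -> exists u, `|x - phi u| < e].
Proof.
exists (completion rho), (cembed rho); split.
- split; first exact: cembed_vjoin.
  move=> u w; rewrite /vmeet linearN; congr (- _).
  by rewrite -!linearN; exact: cembed_vjoin.
- exact: norm_cembed.
- exact: cembed_dense.
Qed.

(** * Factorization *)

(** The value at [x] is chosen to satisfy [mdist p (T u) <= |x - phi u|] for all [u] at once. This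
    single property gives both the factorization, at [x = phi u], and the Lipschitz bound, by
    density. *)
Lemma lipschitz_extension (R : realType) (E : Type) (V : normedModType R)
    (X : completeMetricType R) (phi : E -> V) (T : E -> X) :
  (forall x e, 0 < e -> exists u, `|x - phi u| < e) ->
  (forall u w, mdist (T u) (T w) <= `|phi u - phi w|) ->
  exists2 S : V -> X, T = S \o phi &
    forall x y, mdist (S x) (S y) <= `|x - y|.
Proof.
move=> phi_dense Tphi.
have e0 k : 0 < k.+1%:R^-1 :> R by rewrite invr_gt0.
have /boolp.choice[S SP] : forall x, exists p, forall u,
    mdist p (T u) <= `|x - phi u|.
  move=> x; have /boolp.choice[u uP] := fun k => phi_dense x _ (e0 k).
  have uu k w : mdist (T (u k)) (T w) < k.+1%:R^-1 + `|x - phi w|.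
    apply: le_lt_trans (Tphi _ _) _; rewrite -[phi (u k) - _](subrKA x).
    by apply: le_lt_trans (ler_normD _ _) _; rewrite ltrD2r distrC.
  have [p pP] : exists p, forall k, ball (T (u k)) (2 * (1 / k.+1%:R)) p.
    apply: (@harmonic_limit R X (fun k => T (u k))) => // k l.
    rewrite ballEmdist /= !mul1r; apply: lt_trans (uu k _) _.
    by rewrite ltrD2l.
  exists p => w; apply/ler_addgt0Pl => e e1.
  have [K KP] := harmonic_lt 1 (divr_gt0 e1 (ltr0n R 3)).
  have := pP K; rewrite ballEmdist /= mul1r => pK.
  have := metric_triangle p (T (u K)) (T w); rewrite [mdist p (T (u K))]metric_sym.
  have := uu K w; have := KP K (leqnn K); rewrite mul1r.
  move: pK; move: (K.+1%:R^-1) => d; lra.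
exists S => [|x y].
  apply/funext => u /=; apply/esym/mdist_positivity/eqP.
  by rewrite eq_le mdist_ge0 andbT; have := SP (phi u) u; rewrite subrr normr0.
apply/ler_addgt0Pl => e e1; have e4 : 0 < e / 4 by rewrite divr_gt0.
have [u uP] := phi_dense x _ e4; have [w wP] := phi_dense y _ e4.
have := metric_triangle (S x) (T u) (S y).
have := metric_triangle (T u) (T w) (S y).
have := SP x u; have := SP y w; rewrite [mdist (S y) _]metric_sym.
have := Tphi u w.
have := ler_normD (phi u - x) (x - phi w); rewrite subrKA.
have := ler_normD (x - y) (y - phi w); rewrite subrKA.
rewrite [`|phi u - x|]distrC; lra.
Qed.

Section infimum_bounds.
Context {R : realType}.

(** The reason why [opnorm], [concave_const] and [Lip] are themselves admissible bounds once some
    bound exists. *)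
Lemma le_inf_mul (A : set R) a b : A !=set0 -> 0 <= b ->
  (forall k, A k -> a <= k * b) -> a <= inf A * b.
Proof.
move=> A0; rewrite le_eqVlt => /predU1P[<-|b0] Ab.
  by have [k /Ab] := A0; rewrite !mulr0.
rewrite -ler_pdivrMr //; apply: lb_le_inf => // k /Ab.
by rewrite -ler_pdivrMr.
Qed.

Lemma opnormP (E F : normedModType R) (phi : {linear E -> F}) k :
  0 <= k -> (forall x, `|phi x| <= k * `|x|) ->
  [/\ 0 <= opnorm phi, opnorm phi <= k &
    forall x, `|phi x| <= opnorm phi * `|x|].
Proof.
move=> k0 phik; pose A := [set k | 0 <= k /\ forall x, `|phi x| <= k * `|x|].
have A0 : A !=set0 by exists k.
split; first by apply: lb_le_inf => // l [].
  by apply: ge_inf; [exists 0 => l []|].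
by move=> x; apply: le_inf_mul => // l [_]; exact.
Qed.

Lemma concave_constP (E : banachLatticeType R) (Z : completeNormedModType R)
    (q : \bar R) (S : {linear E -> Z}) M : concave_bound q S M ->
  [/\ 0 <= concave_const q S, concave_const q S <= M &
    concave_bound q S (concave_const q S)].
Proof.
move=> SM; pose A := [set M | concave_bound q S M].
have A0 : A !=set0 by exists M.
have c0 : 0 <= concave_const q S by apply: lb_le_inf => // l [].
split=> //; first by apply: ge_inf => //; exists 0 => l [].
by split=> // n v; apply: le_inf_mul => // l [_]; exact.
Qed.

Lemma LipP (E : normedModType R) (X : metricType R) (f : E -> X) k :
  lip_bound f k -> [/\ 0 <= Lip f, Lip f <= k & lip_bound f (Lip f)].
Proof.
move=> fk; pose A := [set k | lip_bound f k].
have A0 : A !=set0 by exists k.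
have c0 : 0 <= Lip f by apply: lb_le_inf => // l [].
split=> //; first by apply: ge_inf => //; exists 0 => l [].
by split=> // x y; apply: le_inf_mul => // l [_]; exact.
Qed.

End infimum_bounds.

Section factorization.
Context {R : realType} {E : banachLatticeType R} {X : completeMetricType R}.
Context (q : \bar R) (q1 : (1 <= q)%E) (T : E -> X).

(** [S] turns distances into norms in [V], the weights are absorbed by linearity of [phi], concavity
    of [V] applies, and [vwlq_positive_op] brings the expression back to [E]. *)
Lemma factorization_bound (V : banachLatticeType R) (phi : {linear E -> V})
    (S : V -> X) : concave_factorization q T phi S ->
  0 <= opnorm phi * concave_const q (vid V) * Lip S /\
  lip_concave_bound q T (opnorm phi * concave_const q (vid V) * Lip S).
Proof.
move=> [[M /concave_constP[M0 _ [_ VM]]] phi_pos [k /LipP[L0 _ [_ SL]]] TE].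
have [K0 KP] := positive_op_bounded phi_pos.
move=> /(opnormP KP)[N0 _ phiN].
have C0 : 0 <= opnorm phi * concave_const q (vid V) * Lip S.
  by rewrite !mulr_ge0.
split=> //; split=> // n v v' lam lam0.
have [c [c0 cE]] := wlq_absorb q1 lam0.
have one0 : forall j : 'I_n, 0 <= (1 : R) by [].
pose w j := c j *: (v j - v' j).
apply: (@le_trans _ _ (wlq q lam (fun j => Lip S * `|phi (v j - v' j)|))).
  apply: wlq_le => // j; rewrite mdist_ge0 TE /=.
  by rewrite linearB; exact: SL.
rewrite wlqZ // [X in X * `|_|]mulrC -mulrA ler_wpM2l // cE //.
have -> : (fun j => c j * `|phi (v j - v' j)|) = (fun j => `|vid V (phi (w j))|).
  by apply/funext => j; rewrite /= linearZ normrZ ger0_norm.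
apply: le_trans (VM n (fun j => phi (w j))) _.
rewrite [opnorm phi * _]mulrC -mulrA ler_wpM2l //.
rewrite (vwlq_absorb q1 lam0 c0 cE); apply: le_trans (phiN _).
apply: le_vabs_norm; rewrite vabs_id; first exact: vwlq_positive_op.
exact: vwlq_ge0.
Qed.

Lemma lattice_hom_positive (V : banachLatticeType R) (phi : {linear E -> V}) :
  lattice_hom phi -> positive_op phi.
Proof.
by move=> [pj _] x /vle_joinE x0; apply/vle_joinE; rewrite -[0](linear0 phi) -pj x0.
Qed.

(** Both sides of the concavity inequality are Lipschitz in the family, and on the image of [phi] it
    is the hypothesis, because a lattice homomorphism commutes with l^q expressions. *)
Lemma concave_bound_dense (V : banachLatticeType R) (phi : {linear E -> V}) :
  lattice_hom phi -> (forall x e, 0 < e -> exists u, `|x - phi u| < e) ->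
  (forall n (x : 'I_n -> E), wlq q (fun=> 1) (fun k => `|phi (x k)|) <=
    `|phi (vwlq q (fun=> 1) x)|) ->
  concave_bound q (vid V) 1.
Proof.
move=> hphi phi_dense phi_concave; split=> // n v; rewrite mul1r.
have one0 : forall j : 'I_n, 0 <= (1 : R) by [].
have [c c0 cP] := wlq_le_sum q1 one0.
have [b b0 bP] := norm_vwlq_dist q1 one0.
apply/ler_addgt0Pl => e e0.
(* [c] controls the change of the scalar l^q norm and [b] that of the vector expression when the [n]
   vectors are approximated. *)
pose m := (c + b) * n%:R + 1.
have m0 : 0 < m by rewrite ltr_wpDl // mulr_ge0 // addr_ge0.
have d0 : 0 < e / m by rewrite divr_gt0.
have /boolp.choice[x xP] := fun j => phi_dense (v j) _ d0.
have sumP : \sum_j `|v j - phi (x j)| <= e / m * n%:R.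
  rewrite mulr_natr -[n in leRHS]card_ord -sumr_const.
  by apply: ler_sum => j _; exact: ltW.
apply: (@le_trans _ _ (wlq q (fun=> 1) (fun j => `|phi (x j)| + `|v j - phi (x j)|))).
  apply: wlq_le => // j; rewrite normr_ge0 /=.
  by rewrite -{1}[v j](subrKC (phi (x j))) ler_normD.
apply: le_trans (wlq_add q1 one0 _ _) _ => //.
have h1 := phi_concave n x; rewrite (vwlq_lattice_hom q1 _ one0 hphi) in h1.
apply: le_trans (lerD h1 (cP _ (fun j => normr_ge0 _))) _.
have h2 := ler_normD (vwlq q (fun=> 1) (fun j => phi (x j)) - vwlq q (fun=> 1) v)
  (vwlq q (fun=> 1) v).
rewrite subrK distrC [leRHS]addrC in h2.
apply: le_trans (lerD h2 (lexx _)) _; rewrite -[leLHS]addrA [leRHS]addrC lerD2l.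
apply: le_trans (lerD (bP V v (fun j => phi (x j))) (lexx _)) _.
rewrite -mulrDl [b + c]addrC; apply: (@le_trans _ _ ((c + b) * (e / m * n%:R))).
  by rewrite ler_wpM2l // addr_ge0.
have -> : (c + b) * (e / m * n%:R) = e * (((c + b) * n%:R) / m).
  by rewrite -!mulrA [_ * n%:R]mulrC mulrCA; congr (_ * _); rewrite !mulrA.
by rewrite ler_piMr ?(ltW e0) // ler_pdivrMr // mul1r lerDl.
Qed.

(** The bound on the product is C * 1 * 1: [rho] is at most C times the norm, its concavity constant
    1 passes to [V], and [S] is 1-Lipschitz. *)
Lemma factorization_exists C : lip_concave_bound q T C ->
  exists (V : banachLatticeType R) (phi : {linear E -> V}) (S : V -> X),
    [/\ concave_factorization q T phi S, lattice_hom phi, dense (range phi) &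
      opnorm phi * concave_const q (vid V) * Lip S <= C].
Proof.
move=> TC; have [C0 _] := TC.
have [rho [rhoC rhoT rho_concave]] := lip_concave_seminorm q1 TC.
have [V [phi [hphi phiE phi_dense]]] := lattice_seminorm_completion rho.
have [S TE S1] : exists2 S : V -> X, T = S \o phi &
    forall x y, mdist (S x) (S y) <= `|x - y|.
  apply: lipschitz_extension => // u w.
  by rewrite -linearB phiE.
have V1 : concave_bound q (vid V) 1.
  apply: (concave_bound_dense hphi phi_dense) => n x; rewrite phiE.
  rewrite (_ : (fun k => `|phi (x k)|) = (fun k => rho (x k))) //.
  by apply/funext => k; rewrite phiE.
have L1 : lip_bound S 1 by split=> // x y; rewrite mul1r.
exists V, phi, S; split=> //.
- split=> //; [by exists 1|exact: lattice_hom_positive|by exists 1].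
- move=> O [x Ox] oO.
  have /nbhs_ballP[e /= e0 eO] : nbhs x O by apply: open_nbhs_nbhs.
  have [u xu] := phi_dense x e e0; exists (phi u); split; last by exists u.
  by apply: eO; rewrite -ball_normE.
- have [|N0 NC _] := @opnormP _ _ _ phi C C0; first by move=> x; rewrite phiE.
  have [M0 M1 _] := concave_constP V1; have [L0 L1' _] := LipP L1.
  rewrite -[leRHS]mulr1 -[C * 1]mulr1.
  by apply: ler_pM => //; [exact: mulr_ge0|apply: ler_pM].
Qed.

End factorization.

Theorem theorem5p3 (R : realType) (E : banachLatticeType R)
    (X : completeMetricType R) (q : \bar R) (hq : (1 <= q)%E)
    (T : E -> X) (hT : lipschitz_map T) :
  (lip_concave q T <->
     exists (V : banachLatticeType R) (phi : {linear E -> V}) (S : V -> X),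
       concave_factorization q T phi S) /\
  (lip_concave q T ->
     (exists (V : banachLatticeType R) (phi : {linear E -> V}) (S : V -> X),
        [/\ concave_factorization q T phi S, lattice_hom phi
          & dense (range phi)]) /\
     lip_concave_const q T =
       inf [set c : R | exists (V : banachLatticeType R)
              (phi : {linear E -> V}) (S : V -> X),
              concave_factorization q T phi S /\
              c = opnorm phi * concave_const q (vid V) * Lip S]).
Proof.
split.
  split=> [[C /(factorization_exists hq)[V [phi [S [TS _ _ _]]]]]|].
    by exists V, phi, S.
  move=> [V [phi [S /(factorization_bound hq)[_ TC]]]].
  by exists (opnorm phi * concave_const q (vid V) * Lip S).
move=> [C TC]; split.
  have [V [phi [S [TS hphi dphi _]]]] := factorization_exists hq TC.
  by exists V, phi, S.
set B := [set c : R | _].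
(* Supplies the lower bound 0 that [inf] of [B] requires, and places [B] inside the set of
   admissible constants. *)
have B0 c : B c -> 0 <= c /\ lip_concave_bound q T c.
  by move=> [V [phi [S [/(factorization_bound hq) TS ->]]]].
have Bn0 : B !=set0.
  have [V [phi [S [TS _ _ _]]]] := factorization_exists hq TC.
  by exists (opnorm phi * concave_const q (vid V) * Lip S), V, phi, S.
apply/eqP; rewrite eq_le; apply/andP; split.
  apply: lb_le_inf => // c /B0[_ Tc]; apply: ge_inf => //.
  by exists 0 => k [].
apply: lb_le_inf; first by exists C.
move=> k /(factorization_exists hq)[V [phi [S [TS _ _ kC]]]].
apply: le_trans kC; apply: ge_inf; first by exists 0 => c /B0[].
by exists V, phi, S.
Qed.
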